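(* Let $c\ge0$ and let $f:\mathbb R^d\to\mathbb R$ be bounded and measurable with $|f(x)|=O(e^{-c|x|})$ as $|x|\to\infty$. Let $\sigma:\mathbb R\to\mathbb R$ be a nonnegative Lipschitz continuous function, with $\sigma(0)=0$ if $c>0$, and $$L_\sigma:=\inf_{x\in\mathbb R\setminus\{0\}}\frac{|\sigma(x)|}{|x|}>0.$$ Let $\Lambda$ be a Lévy noise with $m_\lambda(q)<\infty$ for some $q\in[1,1+2/d)$ and with $\rho=0$ if $q<2$, and let $Y$ be the mild solution to the stochastic heat equation with these data. If $c=0$, suppose that $L_f:=\inf_{x\in\mathbb R^d}f(x)>0$, while if $c>0$, suppose that $f$ is nonnegative and strictly positive on a set of positive Lebesgue measure. If $b>0$, the following statements are valid. (1) If $c=0$, then $\underline\gamma(1)>0$. (2) If $c>0$, then $\underline\lambda(1)>0$.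
   Context: Noise: on a filtered probability space, $$\Lambda(\mathrm dt,\mathrm dx)=b\,\mathrm dt\,\mathrm dx+\rho\,W(\mathrm dt,\mathrm dx)+\int_{\mathbb R}z\,(\mu-\nu)(\mathrm dt,\mathrm dx,\mathrm dz),$$ where $b,\rho\in\mathbb R$, $W$ is a Gaussian space--time white noise on $(0,\infty)\times\mathbb R^d$, $\mu$ is a Poisson random measure on $(0,\infty)\times\mathbb R^d\times\mathbb R$ with intensity $\nu(\mathrm dt,\mathrm dx,\mathrm dz)=\mathrm dt\,\mathrm dx\,\lambda(\mathrm dz)$, and $\lambda$ is a Lévy measure, i.e. $\lambda(\{0\})=0$, $\int_{\mathbb R}(1\wedge z^2)\,\lambda(\mathrm dz)<\infty$. Put $m_\lambda(q)=\left(\int_{\mathbb R}|z|^q\,\lambda(\mathrm dz)\right)^{1/q}$. Equation: for $\kappa>0$, let $g(t,x)=(2\pi\kappa t)^{-d/2}e^{-|x|^2/(2\kappa t)}$ and $Y_0(t,x)=\int_{\mathbb R^d}g(t,x-y)f(y)\,\mathrm dy$. A mild solution to $\partial_tY=\frac\kappa2\Delta Y+\sigma(Y)\dot\Lambda$, $Y(0,\cdot)=f$, is a predictable process $Y$ with $Y(t,x)=Y_0(t,x)+\int_0^t\int_{\mathbb R^d}g(t-s,x-y)\sigma(Y(s,y))\,\Lambda(\mathrm ds,\mathrm dy)$ for $(t,x)\in(0,\infty)\times\mathbb R^d$. Under the hypotheses of the claim there is $\beta_0>0$ such that there is a unique (up to modifications) mild solution $Y$ with $\sup_{t>0,x\in\mathbb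 R^d}e^{-\beta t+c|x|}\,\mathbb E[|Y(t,x)|^q]^{1/q}<\infty$ for all $\beta\ge\beta_0$; this is the solution $Y$ meant. Exponents: $\underline\gamma(p)=\liminf_{t\to\infty}\frac1t\inf_{x\in\mathbb R^d}\log\mathbb E[|Y(t,x)|^p]$ and $\underline\lambda(p)=\sup\big\{\alpha>0:\limsup_{t\to\infty}\frac1t\sup_{|x|\ge\alpha t}\log\mathbb E[|Y(t,x)|^p]>0\big\}$, with $\sup\emptyset=0$. *)

(* Defs.v *)
From HB Require Import structures.
From mathcomp Require Import all_boot all_order all_algebra.
From mathcomp Require Import all_classical all_reals all_analysis.
From mathcomp Require Import measurable_realfun.

Set Implicit Arguments.
Unset Strict Implicit.
Unset Printing Implicit Defensive.
Import Order.TTheory GRing.Theory Num.Def Num.Theory.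
Import numFieldNormedType.Exports.
Local Open Scope classical_set_scope.
Local Open Scope ring_scope.

(* Time, the coordinates of space and the jump sizes all live in
   [measurableTypeR R], that is [R] with the Borel display that
   [lebesgue_measure] uses. *)
Notation xspace R d := (d.-tuple (measurableTypeR R)).

(* The library's sigma-finite instance for [\x] is shadowed by the one for
   subprobabilities. *)
Lemma product_sigma_finite d1 d2 (T1 : measurableType d1)
    (T2 : measurableType d2) (R : realType)
    (m1 : {sigma_finite_measure set T1 -> \bar R})
    (m2 : {sigma_finite_measure set T2 -> \bar R}) :
  sigma_finite setT (m1 \x m2)%E.
Proof.
have /sigma_finiteP[F [TF ndF Foo]] := sigma_finiteT m1.
have /sigma_finiteP[G [TG ndG Goo]] := sigma_finiteT m2.
exists (fun n => F n `*` G n).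
  rewrite -setXTT TF TG predeqE => -[x y]; split.
    move=> [/= [n _ Fnx] [k _ Gky]]; exists (maxn n k) => //; split.
    - by move: x Fnx; exact/subsetPset/ndF/leq_maxl.
    - by move: y Gky; exact/subsetPset/ndG/leq_maxr.
  by move=> [n _ []/= ? ?]; split; exists n.
move=> k; have [? ?] := Foo k; have [? ?] := Goo k.
split; first exact: measurableX.
by rewrite product_measure1E// lte_mul_pinfty// ge0_fin_numE.
Qed.

(** * Lebesgue measure on R^d *)

Section lebesgue_tuple.
Context {R : realType}.

Definition tcons n (p : measurableTypeR R * xspace R n) : xspace R n.+1 :=
  [tuple of p.1 :: p.2].

Lemma measurable_tcons n : measurable_fun setT (@tcons n).
Proof. by apply: measurable_cons; [exact: measurable_fst|exact: measurable_snd]. Qed.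

Section succ.
Variables (n : nat) (m : {sigma_finite_measure set (xspace R n) -> \bar R}).

(* The product of one-dimensional Lebesgue measure and [m], carried to
   [n.+1]-tuples. *)
Definition lebesgue_cons : set (xspace R n.+1) -> \bar R :=
  pushforward (lebesgue_measure \x m)%E (@tcons n).

Let lebesgue_cons0 : lebesgue_cons set0 = 0%E.
Proof. by rewrite /lebesgue_cons /pushforward preimage_set0 measure0. Qed.

Let lebesgue_cons_ge0 A : (0 <= lebesgue_cons A)%E.
Proof. by rewrite /lebesgue_cons /pushforward; exact: measure_ge0. Qed.

Let lebesgue_cons_sigma_additive : semi_sigma_additive lebesgue_cons.
Proof.
move=> F mF tF mUF; rewrite /lebesgue_cons /pushforward preimage_bigcup.
apply: measure_semi_sigma_additive.
- by move=> k; rewrite -[X in measurable X]setTI; exact: measurable_tcons.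
- apply/trivIsetP => /= i j _ _ ij; rewrite -preimage_setI.
  by move/trivIsetP : tF => /(_ _ _ _ _ ij) ->//; rewrite preimage_set0.
- by rewrite -preimage_bigcup -[X in measurable X]setTI; exact: measurable_tcons.
Qed.

HB.instance Definition _ := isMeasure.Build _ _ _ lebesgue_cons
  lebesgue_cons0 lebesgue_cons_ge0 lebesgue_cons_sigma_additive.

Let lebesgue_cons_sigma_finite : sigma_finite setT lebesgue_cons.
Proof.
have [F FT Foo] := product_sigma_finite lebesgue_measure m.
pose un (v : xspace R n.+1) : measurableTypeR R * xspace R n :=
  (thead v, [tuple of behead v]).
have mun : measurable_fun setT un.
  apply: measurable_fun_pair; first exact: measurable_tnth.
  exact: measurable_behead.
exists (fun k => un @^-1` F k).
  by rewrite -preimage_bigcup -FT preimage_setT.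
move=> k; have [mF Fk] := Foo k; split.
  by rewrite -[X in measurable X]setTI; exact: mun.
suff -> : lebesgue_cons (un @^-1` F k) = (lebesgue_measure \x m)%E (F k) by [].
rewrite /lebesgue_cons /pushforward -comp_preimage; congr (_ _).
rewrite (_ : un \o _ = idfun)//; apply/funext => -[x v] /=.
by congr pair; apply/val_inj.
Qed.

HB.instance Definition _ := Measure_isSigmaFinite.Build _ _ _ lebesgue_cons
  lebesgue_cons_sigma_finite.

End succ.

Fixpoint lebesgue_tuple (n : nat) :
    {sigma_finite_measure set (xspace R n) -> \bar R} :=
  match n return {sigma_finite_measure set (xspace R n) -> \bar R} with
  | 0 => \d_([tuple] : xspace R 0)
  | n'.+1 => lebesgue_cons (lebesgue_tuple n')
  end.

End lebesgue_tuple.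

Definition dist2 (R : realType) d (x y : xspace R d) : R :=
  \sum_(i < d) (tnth x i - tnth y i) ^+ 2.

(* The library norm on vectors is the sup norm. *)
Definition eucl (R : realType) d (x : xspace R d) : R :=
  Num.sqrt (\sum_(i < d) tnth x i ^+ 2).

Definition heat_kernel (R : realType) d (kappa t : R) (x y : xspace R d) : R :=
  (2 * pi * kappa * t) `^ (- (d%:R / 2)) * expR (- dist2 x y / (2 * kappa * t)).

Section noise.
Context dO (Omega : measurableType dO) (R : realType) (P : probability Omega R).
Variable F : R -> set (set Omega).

(** * Filtrations, independence, predictability *)

(* Only the indices [0 <= t] matter; neither completeness nor right-continuity
   is imposed. *)
Definition filtration :=
  (forall t, 0 <= t -> sigma_algebra setT (F t) /\ F t `<=` measurable) /\
  (forall s t, 0 <= s -> s <= t -> F s `<=` F t).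

Definition independent_systems (G H : set (set Omega)) :=
  forall A B, G A -> H B -> P (A `&` B) = (P A * P B)%E.

(* Mutual independence: taking some of the [B i] equal to [setT] gives the
   product rule for every subfamily. *)
Definition independent_family n dV (V : measurableType dV)
    (X : 'I_n -> Omega -> V) :=
  forall B : 'I_n -> set V, (forall i, measurable (B i)) ->
    P [set w | forall i, B i (X i w)] = (\prod_(i < n) P (X i @^-1` B i))%E.

(* The law N(0, v); [normal_prob] is junk for a zero standard deviation. *)
Definition centered_gaussian (X : Omega -> R) (v : R) :=
  if v == 0 then {ae P, forall w, X w = 0}
  else forall B : set R, measurable B ->
    P (X @^-1` B) = normal_prob 0 (Num.sqrt v) B.

(* The law Poisson(r), with Poisson(0) the unit mass at 0 and Poisson(oo) the
   unit mass at oo; [poisson_pmf] is junk at rate 0. *)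
Definition poisson_law (X : Omega -> \bar R) (r : \bar R) :=
  match r with
  | r%:E => forall k : nat,
      P [set w | X w = k%:R%:E] = (r ^+ k / k`!%:R * expR (- r))%:E
  | _ => P [set w | X w = +oo%E] = 1%E
  end.

Section marks.
Context dE (E : measurableType dE).

(* Time-space sets are subsets of [timed E]; only those inside (0, oo) x E
   matter. *)
Definition timed := (measurableTypeR R * E)%type.

Definition during (I : set R) : set timed := [set u | I u.1].

Definition half_space : set timed := during `]0, +oo[.

Definition cell (s t : R) (B : set E) : set timed := `]s, t] `*` B.

(* The predictable sigma-algebra on Omega x (0, oo) x E. *)
Definition predictable_algebra : set (set (Omega * timed)) :=
  <<s [set u | 0 < u.2.1],
      [set C | exists A s t B, [/\ 0 <= s, F s A, measurable B &
                                  C = A `*` cell s t B]] >>.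

Definition predictable (H : Omega * timed -> R) :=
  forall B : set R, measurable B ->
    predictable_algebra ([set u | 0 < u.2.1] `&` H @^-1` B).

(** * White noise and Poisson random measures relative to a filtration *)

(* The sigma-algebra generated by [N A] for measurable [A] in [G] that lie
   in I x E. *)
Definition noise_algebra dV (V : measurableType dV) (G : set (set timed))
    (N : set timed -> Omega -> V) (I : set R) : set (set Omega) :=
  <<s [set C | exists A B, [/\ measurable A, G A, A `<=` during I,
                               measurable B & C = N A @^-1` B]] >>.

Definition nonanticipating dV (V : measurableType dV) (G : set (set timed))
    (N : set timed -> Omega -> V) :=
  forall t, 0 <= t ->
    noise_algebra G N `]0, t] `<=` F t /\
    independent_systems (F t) (noise_algebra G N `]t, +oo[).

Definition white_noise (leb : set timed -> \bar R)
    (W : set timed -> Omega -> R) :=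
  let G := [set A | A `<=` half_space /\ (leb A < +oo)%E] in
  [/\ forall A, measurable A -> G A -> measurable_fun setT (W A),
      forall n (A : 'I_n -> set timed) (a : 'I_n -> R),
        (forall i, measurable (A i) /\ G (A i)) ->
        centered_gaussian (fun w => \sum_(i < n) a i * W (A i) w)
          (\sum_(i < n) \sum_(j < n) a i * a j * fine (leb (A i `&` A j))) &
      nonanticipating G W].

Definition poisson_random_measure (nu : set timed -> \bar R)
    (mu : R.-ker Omega ~> timed) :=
  let G := [set A | A `<=` half_space] in
  [/\ forall A, measurable A -> G A -> poisson_law (mu ^~ A) (nu A),
      forall n (A : 'I_n -> set timed),
        (forall i, measurable (A i) /\ G (A i)) -> trivIset setT A ->
        independent_family (fun i => mu ^~ (A i)) &
      nonanticipating G (fun A => mu ^~ A)].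

(* [mu - nu] on sets of finite [nu]-measure. *)
Definition compensated (nu : set timed -> \bar R)
    (mu : R.-ker Omega ~> timed) (A : set timed) (w : Omega) : R :=
  fine (mu w A) - fine (nu A).

(** * Stochastic integrals of predictable integrands *)

(* sum_i coef_i(w) 1_{]lo_i, hi_i] x mark_i}(s, e) *)
Record simple_integrand := SimpleIntegrand {
  nterms : nat;
  coef : 'I_nterms -> Omega -> R;
  lo : 'I_nterms -> R;
  hi : 'I_nterms -> R;
  mark : 'I_nterms -> set E }.

Definition simple_predictable (m : set E -> \bar R) (S : simple_integrand) :=
  forall i : 'I_(nterms S),
    [/\ 0 <= lo i <= hi i,
        measurable (mark i) /\ (m (mark i) < +oo)%E,
        exists M, forall w, `|coef i w| <= M &
        forall B : set R, measurable B -> F (lo i) (coef i @^-1` B)].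

Definition simple_fun (S : simple_integrand) (u : (Omega * timed)%type) : R :=
  \sum_(i < nterms S) coef i u.1 * \1_(cell (lo i) (hi i) (mark i)) u.2.

Definition simple_integral (N : set timed -> Omega -> R)
    (S : simple_integrand) (w : Omega) : R :=
  \sum_(i < nterms S) coef i w * N (cell (lo i) (hi i) (mark i)) w.

(* [X] is the integral of [H] over (0, oo) x E against the martingale noise
   [N] whose intensity is [ds m(de)]: the extension of [simple_integral] by
   L^1(P)-continuity, where simple integrands approximate [H] for the modular
   E int int phi(H). *)
Definition stochastic_integral (phi : R -> R)
    (m : {sigma_finite_measure set E -> \bar R})
    (N : set timed -> Omega -> R) (H : Omega * timed -> R) (X : Omega -> R) :=
  [/\ predictable H, measurable_fun setT X &
    exists S : nat -> simple_integrand,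
      [/\ forall n, simple_predictable m (S n),
          (\int[P]_w \int[lebesgue_measure \x m]_(u in half_space)
             (phi (H (w, u) - simple_fun (S n) (w, u)))%:E)%E
            @[n --> \oo] --> 0%E &
          ('E_P[fun w => `|simple_integral N (S n) w - X w|%R])%E
            @[n --> \oo] --> 0%E]].

End marks.
Arguments half_space {dE E}.

(** * The Levy noise and the stochastic heat equation *)

Section equation.
Variables (d : nat) (b rho : R).
Variables (W : set (timed (xspace R d)) -> Omega -> R).
Variables (lambda : {sigma_finite_measure set (measurableTypeR R) -> \bar R}).
Variables (mu : R.-ker Omega ~> timed (xspace R d * measurableTypeR R)%type).

Let leb : set (timed (xspace R d)) -> \bar R :=
  (lebesgue_measure \x lebesgue_tuple d)%E.

Definition mark_measure : set (xspace R d * measurableTypeR R)%type -> \bar R :=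
  (lebesgue_tuple d \x lambda)%E.
HB.instance Definition _ := Measure.on mark_measure.
HB.instance Definition _ := Measure_isSigmaFinite.Build _ _ _ mark_measure
  (product_sigma_finite (lebesgue_tuple d) lambda).

Definition intensity : set (timed (xspace R d * measurableTypeR R)%type)
    -> \bar R := (lebesgue_measure \x mark_measure)%E.

(* Sigma-finiteness, part of the type of [lambda], is a consequence. *)
Definition levy_measure :=
  lambda [set 0] = 0%E /\
  (\int[lambda]_z (Num.min 1 (z ^+ 2))%:E < +oo)%E.

Definition m_lambda (q : R) : \bar R :=
  ((\int[lambda]_z (`|z| `^ q)%:E) `^ q^-1)%E.

(* Independence of [W] and [mu] is automatic for a white noise and a Poisson
   random measure relative to the same filtration. *)
Definition levy_noise :=
  [/\ levy_measure, white_noise leb W & poisson_random_measure intensity mu].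

(* [X] is the integral of [H] over (0, oo) x R^d against
   b dt dx + rho W(dt, dx) + int z (mu - nu)(dt, dx, dz). The factor [rho] is
   inside the white-noise integral, so that no square integrability of [H] is
   asked when [rho = 0]. For the jump part, E int int |K| /\ K^2 d nu < oo is
   the condition under which the compensated integral of [K] is defined in
   L^1; it holds for every [K] in L^p(P x nu), 1 <= p <= 2. *)
Definition levy_integral (H : Omega * timed (xspace R d) -> R)
    (X : Omega -> R) :=
  exists IW IN : Omega -> R,
    [/\ {ae P, forall w, (lebesgue_measure \x lebesgue_tuple d)%E.-integrable
           half_space (fun u => (b * H (w, u))%:E)},
        stochastic_integral (fun x => x ^+ 2) (lebesgue_tuple d) W
          (fun u => rho * H u) IW,
        stochastic_integral (fun x => Num.min `|x| (x ^+ 2)) mark_measure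
          (compensated intensity mu)
          (fun u => let: (w, (s, (y, z))) := u in H (w, (s, y)) * z) IN &
        {ae P, forall w, X w =
          \int[(lebesgue_measure \x lebesgue_tuple d)%E]_(u in half_space)
             (b * H (w, u)) + IW w + IN w}].

Definition initial_part (kappa : R) (f : xspace R d -> R) (t : R)
    (x : xspace R d) : R :=
  \int[lebesgue_tuple d]_y (heat_kernel kappa t x y * f y).

Definition mild_solution (kappa : R) (sigma : R -> R) (f : xspace R d -> R)
    (Y : R -> xspace R d -> Omega -> R) :=
  predictable (fun u : Omega * timed (xspace R d) => Y u.2.1 u.2.2 u.1) /\
  forall t x, 0 < t -> exists X : Omega -> R,
    levy_integral (fun u : Omega * timed (xspace R d) =>
        let: (w, (s, y)) := u in
        if 0 < s < t then heat_kernel kappa (t - s) x y * sigma (Y s y w)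
        else 0) X /\
    {ae P, forall w, Y t x w = initial_part kappa f t x + X w}.

End equation.

Section exponents.
Variables (d : nat) (Y : R -> xspace R d -> Omega -> R).

Definition moment (p t : R) (x : xspace R d) : \bar R :=
  ('E_P[fun w => (`|Y t x w| `^ p)%R])%E.

Definition moment_bound (c q : R) :=
  exists2 beta0, 0 < beta0 & forall beta, beta0 <= beta ->
    (ereal_sup [set (expR (- beta * tx.1 + c * eucl tx.2))%:E *
                    moment q tx.1 tx.2 `^ q^-1
               | tx in [set tx : R * xspace R d | (0 < tx.1)%R]] < +oo)%E.

Definition gamma_lower (p : R) : \bar R :=
  limf_einf (fun t : R =>
    ((t^-1)%:E * ereal_inf [set lne (moment p t x) | x in setT])%E) +oo.

(* The element 0 encodes the convention [sup set0 = 0]. *)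
Definition lambda_lower (p : R) : \bar R :=
  ereal_sup ([set 0%E] `|` [set alpha%:E | alpha in [set alpha : R |
    0 < alpha /\
    (0 < limf_esup (fun t : R => (t^-1)%:E *
           ereal_sup [set lne (moment p t x)
                     | x in [set x | (alpha * t <= eucl x)%R]]) +oo%R)%E]]).

End exponents.

End noise.

Definition L_sigma (R : realType) (sigma : R -> R) : R :=
  inf [set `|sigma x| / `|x| | x in [set x | x != 0]].

Definition exp_decay (R : realType) d (c : R) (f : xspace R d -> R) :=
  exists C r : R, forall x, r <= eucl x -> `|f x| <= C * expR (- c * eucl x).

(* Main.v *)
(** Taking expectations in the mild formulation kills the martingale integrals,
    and sigma(v) >= L_sigma |v|, so u(t,x) = E|Y(t,x)| satisfies
      u(t,x) >= Y_0(t,x) + b L_sigma int_0^t int g(t-s,x-y) u(s,y) dy ds.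
    By the semigroup property of the heat kernel, g(t-s) convolved with Y_0(s) is
    Y_0(t), so iterating the inequality multiplies Y_0 by the partial sums of the
    exponential series and u(t,x) >= exp(b L_sigma t) Y_0(t,x). If f >= L_f > 0,
    then Y_0 >= L_f. If f > 0 only on a set of positive measure, then
    Y_0(t,x) is at least of order t^(-d/2) exp(-|x|^2/(kappa t)), and on the
    sphere |x| = alpha t with alpha small the factor exp(b L_sigma t) wins. *)

From HB Require Import structures.
Require Import Defs.
From mathcomp Require Import all_boot all_order all_algebra.
From mathcomp Require Import all_classical all_reals all_analysis.
From mathcomp Require Import measurable_realfun ring lra.

Set Implicit Arguments.
Unset Strict Implicit.
Unset Printing Implicit Defensive.
Import Order.TTheory GRing.Theory Num.Theory.
Import numFieldNormedType.Exports.
Local Open Scope classical_set_scope.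
Local Open Scope ring_scope.

(** * Martingale integrals have mean zero *)

(** Taking expectations in the equation yields E Y, yet the inequality closes in E|Y|: E Y is at
    most E|Y| on one side and [sigma](Y) >= L|Y| on the other, so Y may have either sign. All
    comparisons are made in the extended reals. Where E|Y(t,x)| is infinite there is nothing to
    show; elsewhere the drift integral is almost surely a combination of integrable variables, and
    its nonnegative integrand allows Tonelli. The martingale terms have mean zero straight from the
    definition of the integral as an L^1(P)-limit of simple integrals. For the iteration, the
    partial sums p_n of the exponential series satisfy p_{n+1}' = a p_n and p_{n+1}(0) = 1. The
    semigroup property turns the space integral of g(t-s) p_n(s) Y_0(s) into p_n(s) Y_0(t,x), so
    each step integrates a polynomial in time, and n goes to infinity pointwise at the very end. *)

Section probability.
Context {R : realType} {dO : measure_display} {Omega : measurableType dO}.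
Variable P : probability Omega R.

Lemma integrable_bounded_mul (c X : Omega -> R) (M : R) :
  measurable_fun setT c -> (forall w, `|c w| <= M) ->
  P.-integrable setT (EFin \o X) ->
  P.-integrable setT (fun w => (c w * X w)%:E).
Proof.
move=> mc cM iX.
have mX : measurable_fun setT X by apply/measurable_EFinP/(measurable_int P).
have iMX : P.-integrable setT (fun w => M%:E * (X w)%:E)%E by exact: integrableZl.
apply: (le_integrable measurableT _ _ iMX).
  by apply/measurable_EFinP; exact: measurable_funM.
move=> w _ /=; rewrite lee_fin normrM [leRHS]normrM ler_wpM2r//.
by rewrite (le_trans (cM w))// ler_norm.
Qed.

(** Independence makes the joint law of [c] and [X] the product of their laws, since the two agree
    on rectangles. Fubini then leaves inner integrals equal to x * E X = 0. *)
Lemma independent_mul_mean0 (c X : Omega -> R) (M : R) :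
  measurable_fun setT c -> (forall w, `|c w| <= M) ->
  P.-integrable setT (EFin \o X) ->
  (forall A B : set (R), measurable A -> measurable B ->
    P (c @^-1` A `&` X @^-1` B) = (P (c @^-1` A) * P (X @^-1` B))%E) ->
  (\int[P]_w (X w)%:E = 0)%E -> (\int[P]_w (c w * X w)%:E = 0)%E.
Proof.
move=> mc cM iX indep X0.
have mX : measurable_fun setT X by apply/measurable_EFinP/(measurable_int P).
have icX := integrable_bounded_mul mc cM iX.
pose c' : {mfun Omega >-> R} := HB.pack c (isMeasurableFun.Build _ _ _ _ _ mc).
pose X' : {mfun Omega >-> R} := HB.pack X (isMeasurableFun.Build _ _ _ _ _ mX).
pose pc : {sigma_finite_measure set _ -> \bar R} := distribution P c'.
pose pX : {sigma_finite_measure set _ -> \bar R} := distribution P X'.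
have mcX : measurable_fun setT (fun w => (c w, X w) : R * R).
  exact: measurable_fun_pair.
pose cX' : {mfun Omega >-> (R * R)%type} := HB.pack (fun w => (c w, X w))
  (isMeasurableFun.Build _ _ _ _ _ mcX).
pose J : {measure set (R * R) -> \bar R} := distribution P cX'.
have JE : forall A, measurable A -> (pc \x pX)%E A = J A.
  by apply: product_measure_unique => A B mA mB; exact: indep.
have JI h : (\int[J]_u h u = \int[pc \x pX]_u h u)%E.
  by apply: eq_measure_integral => A mA _; exact/esym/JE.
pose g (u : R * R) : \bar R := (u.1 * u.2)%:E.
have mg : measurable_fun setT g.
  apply/measurable_EFinP/measurable_funM; first exact: measurable_fst.
  exact: measurable_snd.
have ig : J.-integrable setT g by exact: (integrable_pushforward mcX).
have igp : (pc \x pX)%E.-integrable setT g.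
  by apply/integrableP; split=> //; rewrite -JI; have /integrableP[] := ig.
transitivity (\int[J]_u g u)%E; first by rewrite integral_pushforward.
rewrite JI.
rewrite -integral12_prod_meas1// integral0_eq// => x _.
rewrite /fubini_F /g/=; under eq_integral do rewrite EFinM.
have iXX : pX.-integrable setT EFin.
  by apply: integrable_pushforward.
rewrite integralZl// integral_pushforward// [X in (_ * X)%E](_ : _ = 0)%E ?mule0//.
Qed.

End probability.

(** * First moments of Gaussian and Poisson variables *)

Lemma abs_normal_fun_le (R : realType) (s x : R) : s != 0 ->
  `|x| * normal_fun 0 s x <=
  (1 + 8 / 3 * s ^+ 2) * normal_fun 0 (s *+ 2) x.
Proof.
move=> s0; have s2 : 0 < s ^+ 2 by rewrite exprn_even_gt0.
(* [|x| <= 1 + x ^+ 2], and [expR y >= 1 + y] absorbs the factor. *)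
pose y := 3 * x ^+ 2 / (8 * s ^+ 2).
have y0 : 0 <= y by apply: divr_ge0; apply: mulr_ge0; rewrite ?sqr_ge0 ?ler0n.
have -> : normal_fun 0 s x = expR (- y) * normal_fun 0 (s *+ 2) x.
  by rewrite /normal_fun -expRD; congr expR; rewrite /y !subr0; field.
rewrite mulrA ler_wpM2r ?normal_fun_ge0// expRN ler_pdivrMr ?expR_gt0//.
(* The constant is such that [8 / 3 * s ^+ 2 * y] is exactly [x ^+ 2]. *)
apply: (@le_trans _ _ ((1 + 8 / 3 * s ^+ 2) * (1 + y))); last first.
  by rewrite ler_wpM2l ?expR_ge1Dx// addr_ge0// mulr_ge0 ?ltW.
have -> : (1 + 8 / 3 * s ^+ 2) * (1 + y) = 1 + y + 8 / 3 * s ^+ 2 + x ^+ 2.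
  by rewrite /y; field.
have : `|x| <= 1 + x ^+ 2.
  by rewrite -real_normK ?num_real//; set z := `|x|; nra.
have : 0 <= 8 / 3 * s ^+ 2 by rewrite mulr_ge0 ?ltW.
lra.
Qed.

(** The Radon-Nikodym derivative moves the integral to Lebesgue measure, where a multiple of the
    Gaussian density with doubled standard deviation dominates. *)
Lemma normal_prob_abs_lty (R : realType) (s : R) : s != 0 ->
  (\int[normal_prob 0 s]_x `|x%:E| < +oo)%E.
Proof.
move=> s0; have s20 : s *+ 2 != 0 by rewrite mulrn_eq0.
have dom := @normal_prob_dominates R 0 s.
rewrite -(Radon_Nikodym_SigmaFinite.change_of_variables dom)//; last first.
  exact: measurableT_comp.
have RNE : ae_eq lebesgue_measure setT
    (Radon_Nikodym_SigmaFinite.f (normal_prob 0 s) lebesgue_measure)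
    (fun x => (normal_pdf 0 s x)%:E).
  apply: integral_ae_eq => //.
  - exact: Radon_Nikodym_SigmaFinite.f_integrable.
  - by apply/measurable_EFinP; exact: measurable_normal_pdf.
  - by move=> E _ mE; rewrite -Radon_Nikodym_SigmaFinite.f_integral.
have mabs : measurable_fun setT (fun x : measurableTypeR R => `|x%:E|%E).
  exact: measurableT_comp.
rewrite [X in (X < _)%E](_ : _ =
    \int[lebesgue_measure]_x (`|x%:E| * (normal_pdf 0 s x)%:E))%E; last first.
  apply: ae_eq_integral => //.
  - apply: emeasurable_funM => //; apply: (measurable_int lebesgue_measure).
    exact: Radon_Nikodym_SigmaFinite.f_integrable.
  - apply: emeasurable_funM => //.
    by apply/measurable_EFinP; exact: measurable_normal_pdf.
  - exact: ae_eqe_mul2l.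
(* The quotient of the peaks turns the bound between unnormalized exponentials into one between
   densities. *)
pose C := normal_peak s * ((1 + 8 / 3 * s ^+ 2) / normal_peak (s *+ 2)).
have C0 : 0 <= C.
  rewrite mulr_ge0 ?normal_peak_ge0// divr_ge0 ?normal_peak_ge0//.
  by rewrite addr_ge0// mulr_ge0 ?sqr_ge0.
apply: (@le_lt_trans _ _
  (\int[lebesgue_measure]_x (C%:E * (normal_pdf 0 (s *+ 2) x)%:E))%E).
  apply: ge0_le_integral => //.
  - by move=> x _; rewrite mule_ge0// lee_fin normal_pdf_ge0.
  - apply: emeasurable_funM => //.
    by apply/measurable_EFinP; exact: measurable_normal_pdf.
  - apply: emeasurable_funM => //.
    by apply/measurable_EFinP; exact: measurable_normal_pdf.
  - move=> x _; rewrite -EFinM lee_fin !normal_pdfE// /C.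
    rewrite mulrCA [leRHS](_ : _ = normal_peak s *
        ((1 + 8 / 3 * s ^+ 2) * normal_fun 0 (s *+ 2) x)); last first.
      by field; rewrite gt_eqF ?normal_peak_gt0.
    by rewrite ler_wpM2l ?normal_peak_ge0// abs_normal_fun_le.
rewrite ge0_integralZl//.
- by rewrite integral_normal_pdf mule1 ltry.
- by apply/measurable_EFinP; exact: measurable_normal_pdf.
- by move=> x _; rewrite lee_fin normal_pdf_ge0.
Qed.

Section moments.
Context {R : realType} {dO : measure_display} {Omega : measurableType dO}.
Variable P : probability Omega R.

Lemma centered_gaussian_integrable (X : Omega -> R) (v : R) :
  0 <= v -> measurable_fun setT X -> centered_gaussian P X v ->
  P.-integrable setT (EFin \o X).
Proof.
rewrite /centered_gaussian => v0 mX; case: eqP => [_ X0|/eqP vn0 XE].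
  apply/integrableP; split; first exact/measurable_EFinP.
  rewrite (ae_eq_integral (cst 0%E))//; first by rewrite integral0.
    by apply: measurableT_comp => //; exact/measurable_EFinP.
  by apply: filterS X0 => w /= -> _; rewrite normr0.
pose X' : {mfun Omega >-> measurableTypeR R} :=
  HB.pack (X : Omega -> measurableTypeR R)
    (@isMeasurableFun.phant_Build _ _ _ (measurableTypeR R) _ mX).
apply/integrableP; split; first exact/measurable_EFinP.
have := @ge0_integral_distribution _ _ _ _ _ P X' (fun x => `|x%:E|)%E.
move=> /= <-//; last exact: measurableT_comp.
rewrite (@eq_measure_integral _ _ _ _ (normal_prob 0 (Num.sqrt v))).
  by apply: normal_prob_abs_lty; rewrite gt_eqF// sqrtr_gt0 lt_neqAle eq_sym vn0.
by move=> A mA _; exact: XE.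
Qed.

(* The first moment is read off the equality of the laws of [X] and [- X]. *)
Lemma centered_gaussian_sym_mean0 (X : Omega -> R) (v : R) :
  0 <= v -> measurable_fun setT X -> centered_gaussian P X v ->
  centered_gaussian P (fun w => - X w) v ->
  (\int[P]_w (X w)%:E = 0)%E.
Proof.
move=> v0 mX gX gN; have iX := centered_gaussian_integrable v0 mX gX.
move: gX gN; rewrite /centered_gaussian; case: eqP => [_ X0 _|/eqP vn0 gX gN].
  rewrite (ae_eq_integral (cst 0%E))//; first by rewrite integral0.
    exact/measurable_EFinP.
  by apply: filterS X0 => w /= -> _.
have mN : measurable_fun setT (fun w => - X w) by exact: measurable_funN.
pose X' : {mfun Omega >-> R} := HB.pack X (isMeasurableFun.Build _ _ _ _ _ mX).
pose N' : {mfun Omega >-> R} :=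
  HB.pack (fun w => - X w) (isMeasurableFun.Build _ _ _ _ _ mN).
have XN : (\int[P]_w (X w)%:E = \int[P]_w (- X w)%:E)%E.
  have := @integral_distribution _ _ _ _ _ P X' EFin.
  move=> <-//; have := @integral_distribution _ _ _ _ _ P N' EFin.
  move=> /= <-//; last exact: (integrableN iX).
  apply: eq_measure_integral => A mA _.
  by transitivity (normal_prob 0 (Num.sqrt v) A); [exact: gX|exact/esym/gN].
move: XN; under [in RHS]eq_integral do rewrite EFinN.
rewrite integralN//=; last first.
  by apply: integrable_add_def.
have : (\int[P]_w (X w)%:E)%E \is a fin_num by exact: integrable_fin_num.
case: (\int[P]_w (X w)%:E)%E => // r _ [rN]; congr EFin.
lra.
Qed.

Lemma cvg_series_poisson (r : R) :
  series (fun k => r ^+ k / k`!%:R * expR (- r)) @ \oo --> (1 : R).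
Proof.
rewrite (_ : series _ = fun n => series (exp_coeff r) n * expR (- r)); last first.
  by apply/funext => n; rewrite /series/= mulr_suml.
have -> : (1 : R) = expR r * expR (- r) by rewrite -expRD subrr expR0.
by apply: cvgMr_tmp; exact: is_cvg_series_exp_coeff.
Qed.

Lemma cvg_series_poisson_mean (r : R) :
  series (fun k => k%:R * (r ^+ k / k`!%:R * expR (- r))) @ \oo --> r.
Proof.
(* The term k = 0 vanishes, and k / k! = 1 / (k-1)! makes the shifted series r times the series of
   masses. *)
rewrite -(cvg_shiftn 1).
rewrite (_ : (fun _ => _) = fun n =>
    r * series (fun k => r ^+ k / k`!%:R * expR (- r)) n); last first.
  apply/funext => n; rewrite addn1 /series/= big_nat_recl//= mul0r add0r mulr_sumr.
  apply: eq_bigr => k _; rewrite exprS factS natrM.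
  by field; rewrite pnatr_eq0 -lt0n fact_gt0/= nat1r pnatr_eq0.
have h := @cvgMl_tmp _ _ \oo _ _ r _ (@cvg_series_poisson r); rewrite mulr1 in h.
exact: h.

Qed.

Lemma nneseries_EFin_cvg (u : nat -> R) (l : R) :
  series u @ \oo --> l -> (\sum_(k <oo) (u k)%:E = l%:E)%E.
Proof.
move=> ul; apply/cvg_lim => //.
rewrite (_ : (fun _ => _) = EFin \o series u); last first.
  by apply/funext => n; rewrite /series/= sumEFin.
by apply: cvg_EFin => //; exact: nearW.
Qed.

(** The law prescribes only the masses of the atoms. They sum to 1, so every other value, including
    +oo which [fine] sends to 0, is taken on a negligible event, and the integral is a series over
    the atoms. *)
Lemma poisson_law_mean (X : Omega -> \bar R) (r : R) :
  measurable_fun setT X -> (forall w, 0 <= X w)%E ->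
  poisson_law P X r%:E ->
  P.-integrable setT (fun w => (fine (X w))%:E) /\
  (\int[P]_w (fine (X w))%:E = r%:E)%E.
Proof.
move=> mX X0 /= XE.
pose E k : set Omega := [set w | X w = k%:R%:E].
have mE k : measurable (E k).
  have -> : E k = setT `&` X @^-1` [set k%:R%:E] by rewrite setTI.
  by apply: mX => //; exact: emeasurable_set1.
have tE : trivIset setT E.
  apply/trivIsetP => i j _ _ ij; apply/seteqP; split=> // w [Xi].
  rewrite /E/= Xi => -[/eqP].
  by rewrite eqr_nat (negbTE ij).
have mU : measurable (\bigcup_k E k) by exact: bigcupT_measurable.
have PU : P (\bigcup_k E k) = 1%E.
  rewrite measure_bigcup//; under eq_eseriesl do rewrite in_setT.
  rewrite -(nneseries_EFin_cvg (@cvg_series_poisson r)).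
  by apply: eq_eseriesr => k _; exact: XE.
have mf : measurable_fun setT (fun w => (fine (X w))%:E).
  by apply/measurable_EFinP; apply: measurableT_comp.
have f0 w : (0 <= (fine (X w))%:E)%E by rewrite lee_fin fine_ge0.
have fE : (\int[P]_w (fine (X w))%:E = r%:E)%E.
  have P0 : P (~` \bigcup_k E k) = 0%E by rewrite probability_setC// PU subee.
  rewrite (ge0_negligible_integral (measurableC mU) measurableT mf _ P0)//.
  rewrite setTD setCK ge0_integral_bigcup//; last exact: measurable_funTS.
  rewrite -(nneseries_EFin_cvg (@cvg_series_poisson_mean r)).
  apply: eq_eseriesr => k _.
  rewrite (eq_integral (cst k%:R%:E)); last first.
    by move=> w /[!inE] Xw; rewrite (Xw : X w = _).
  by rewrite integral_cst// EFinM; congr (_ * _)%E; exact: XE.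
split=> //; apply/integrableP; split=> //.
by under eq_integral do rewrite gee0_abs//; rewrite fE ltry.
Qed.

End moments.

(** * Integrals against noises with centered, independent increments *)

Section martingale_noise.
Context {R : realType} {dO : measure_display} {Omega : measurableType dO}.
Variables (P : probability Omega R) (F : R -> set (set Omega)).
Context {dE : measure_display} {E : measurableType dE}.
Variable m : {sigma_finite_measure set E -> \bar R}.

(* What makes the integral of a simple predictable integrand centered. *)
Definition mean_zero_noise (N : set (timed R E) -> Omega -> R) :=
  forall (s t : R) (B : set E), 0 <= s <= t -> measurable B -> (m B < +oo)%E ->
    [/\ P.-integrable setT (EFin \o N (cell s t B)),
        (\int[P]_w (N (cell s t B) w)%:E = 0)%E &
        forall G (D : set R), F s G -> measurable D ->
          P (G `&` N (cell s t B) @^-1` D) = (P G * P (N (cell s t B) @^-1` D))%E].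

Lemma filtration_measurable (s : R) (X : Omega -> R) :
  filtration F -> 0 <= s ->
  (forall B : set R, measurable B -> F s (X @^-1` B)) -> measurable_fun setT X.
Proof.
move=> [Fs _] s0 FX _ B mB; rewrite setTI.
by have [_] := Fs _ s0; apply; exact: FX.
Qed.

(** Each coefficient is bounded and known at time [lo i], while the noise on its cell is centered
    and independent of [F (lo i)]. *)
Lemma simple_integral_mean0 (N : set (timed R E) -> Omega -> R)
    (S : simple_integrand Omega R E) :
  filtration F -> mean_zero_noise N -> simple_predictable F m S ->
  P.-integrable setT (EFin \o simple_integral N S) /\
  (\int[P]_w (simple_integral N S w)%:E = 0)%E.
Proof.
move=> FF NN pS.
have H (i : 'I_(nterms S)) :
    P.-integrable setT (fun w => (coef i w * N (cell (lo i) (hi i) (mark i)) w)%:E) /\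
    (\int[P]_w (coef i w * N (cell (lo i) (hi i) (mark i)) w)%:E = 0)%E.
  have [lohi [mm mfin] [M cM] Fc] := pS i.
  have [iN N0 indep] := NN _ _ _ lohi mm mfin.
  have lo0 : 0 <= lo i by case/andP: lohi.
  have mc := filtration_measurable FF lo0 Fc.
  split; first exact: (integrable_bounded_mul mc cM).
  apply: (independent_mul_mean0 mc cM) => // A B mA mB.
  by apply: indep => //; exact: Fc.
have -> : EFin \o simple_integral N S = fun w => (\sum_(i < nterms S)
    (coef i w * N (cell (lo i) (hi i) (mark i)) w)%:E)%E.
  by apply/funext => w; rewrite /simple_integral/= sumEFin.
split; first by apply: integrable_sum => // i _; have [] := H i.
rewrite (eq_integral (fun w => \sum_(i < nterms S)
    (coef i w * N (cell (lo i) (hi i) (mark i)) w)%:E)%E); last first.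
  by move=> w _; rewrite /simple_integral/= sumEFin.
rewrite integral_sum//; last by move=> i; have [] := H i.
by rewrite big1// => i _; have [] := H i.
Qed.

(** The simple integrals S_n have mean zero, so |E X| = |E (S_n - X)| <= E|S_n - X|, which tends to
    0. *)
Lemma stochastic_integral_mean0 (phi : R -> R) (N : set (timed R E) -> Omega -> R)
    (H : Omega * timed R E -> R) (X : Omega -> R) :
  filtration F -> mean_zero_noise N -> stochastic_integral P F phi m N H X ->
  P.-integrable setT (EFin \o X) /\ (\int[P]_w (X w)%:E = 0)%E.
Proof.
move=> FF NN [_ mX [S [pS _ SX]]].
have HS n := simple_integral_mean0 FF NN (pS n).
pose D n : \bar R := (\int[P]_w (`|simple_integral N (S n) w - X w|)%:E)%E.
have D0 : D @ \oo --> 0%E.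
  by move: SX; rewrite /D; under eq_fun do rewrite unlock.
have small (e : R) : 0 < e -> exists n, (D n < e%:E)%E.
  move=> e0; have [n _ /(_ n (leqnn n))/= Dn] : \forall n \near \oo, (D n < e%:E)%E.
    exact: (D0 _ (nbhs_open_ereal_lt (f := fun=> e) e0)).
  by exists n.
have mSX n : measurable_fun setT (fun w => simple_integral N (S n) w - X w).
  apply: measurable_funB => //; apply/measurable_EFinP.
  by have [/measurable_int] := HS n.
have iD n : (D n < +oo)%E -> P.-integrable setT
    (fun w => (simple_integral N (S n) w - X w)%:E).
  by move=> Dn; apply/integrableP; split => //; exact/measurable_EFinP.
(* One approximant at finite L^1-distance already makes [X] integrable. *)
have [n0 Dn0] := small 1 ltr01.
have iX : P.-integrable setT (EFin \o X).
  have [iS _] := HS n0.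
  have := integrableB measurableT iS (iD n0 (lt_trans Dn0 (ltry _))).
  by apply: eq_integrable => // w _ /=; rewrite -EFinB subKr.
split=> //.
have fX : (\int[P]_w (X w)%:E)%E \is a fin_num by exact: integrable_fin_num.
apply/eqP; rewrite -abse_eq0 eq_le abse_ge0 andbT.
apply/lee_addgt0Pr => e e0; rewrite add0e.
have [n Dn] := small e e0; apply: ltW; apply: le_lt_trans Dn.
have [iS S0] := HS n.
have -> : (\int[P]_w (X w)%:E = - \int[P]_w (simple_integral N (S n) w - X w)%:E)%E.
  under [in RHS]eq_integral do rewrite EFinB.
  by rewrite integralB//= S0 sub0e oppeK.
rewrite abseN; apply: le_abse_integral => //; exact/measurable_EFinP.
Qed.

End martingale_noise.

(** * White noise and compensated Poisson noise; joint measurability *)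

Section noises.
Context {R : realType} {dO : measure_display} {Omega : measurableType dO}.
Variables (P : probability Omega R) (F : R -> set (set Omega)).
Context {dE : measure_display} {E : measurableType dE}.
Variable m : {sigma_finite_measure set E -> \bar R}.

Lemma measurable_cell (s t : R) (B : set E) : measurable B -> measurable (cell s t B).
Proof. by move=> mB; apply: measurableX. Qed.

Lemma measurable_half_space : measurable (@half_space R _ E).
Proof.
rewrite (_ : @half_space R _ E = `]0, +oo[ `*` setT); first exact: measurableX.
by apply/seteqP; split=> -[r e] // [].
Qed.

Lemma cell_half_space (s t : R) (B : set E) : 0 <= s -> cell s t B `<=` @half_space R _ E.
Proof.
move=> s0 -[x e] [/=]; rewrite in_itv/= => /andP[sx _] _.
by rewrite /half_space /during /= in_itv/= andbT (le_lt_trans s0).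
Qed.

Lemma cell_during (s t : R) (B : set E) : cell s t B `<=` during `]s, +oo[.
Proof.
move=> -[x e] [/=]; rewrite in_itv/= => /andP[sx _] _.
by rewrite /during /= in_itv/= andbT.
Qed.

Lemma product_measure_cell (s t : R) (B : set E) : s <= t -> measurable B ->
  (lebesgue_measure \x m)%E (cell s t B) = ((t - s)%:E * m B)%E.
Proof.
move=> st mB; rewrite /cell product_measure1E//=.
by rewrite lebesgue_measure_itv/= lte_fin; case: ltgtP st => //= -> _; rewrite subrr.
Qed.

Lemma product_measure_cell_lty (s t : R) (B : set E) : s <= t -> measurable B ->
  (m B < +oo)%E -> ((lebesgue_measure \x m)%E (cell s t B) < +oo)%E.
Proof.
move=> st mB Boo; rewrite product_measure_cell// lte_mul_pinfty//.
by rewrite lee_fin subr_ge0.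
Qed.

Lemma white_noise_mean_zero (W : set (timed R E) -> Omega -> R) :
  white_noise P F (lebesgue_measure \x m)%E W -> mean_zero_noise P F m W.
Proof.
move=> [mW gW nW] s t B /andP[s0 st] mB Boo.
set A := cell s t B.
have mA : measurable A by exact: measurable_cell.
have hA : A `<=` @half_space R _ E by exact: cell_half_space.
have fA : ((lebesgue_measure \x m)%E A < +oo)%E by exact: product_measure_cell_lty.
pose v := fine ((lebesgue_measure \x m)%E A).
have v0 : 0 <= v by rewrite /v fine_ge0.
have mWA : measurable_fun setT (W A) by exact: mW.
(* The joint Gaussian law, for a single set with coefficient 1 and then -1, gives [W A] and its
   opposite the same variance [v]. *)
have g1 : centered_gaussian P (W A) v.
  have := gW 1%N (fun=> A) (fun=> 1) (fun=> conj mA (conj hA fA)).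
  rewrite !big_ord1 setIid !mul1r.
  by under eq_fun do rewrite big_ord1 mul1r.
have gN : centered_gaussian P (fun w => - W A w) v.
  have := gW 1%N (fun=> A) (fun=> -1) (fun=> conj mA (conj hA fA)).
  rewrite !big_ord1 setIid mulrNN !mul1r.
  by under eq_fun do rewrite big_ord1 mulN1r.
split.
- exact: centered_gaussian_integrable g1.
- exact: centered_gaussian_sym_mean0 g1 gN.
- move=> G D FG mD; have [_ ind] := nW s s0; apply: ind => //.
  apply: sub_sigma_algebra; exists A, D; split=> //.
  exact: cell_during.
Qed.

Lemma poisson_mean_zero (mu : R.-ker Omega ~> timed R E) :
  poisson_random_measure P F (lebesgue_measure \x m)%E mu ->
  mean_zero_noise P F m (compensated (lebesgue_measure \x m)%E mu).
Proof.
move=> [pmu _ nmu] s t B /andP[s0 st] mB Boo.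
set A := cell s t B.
have mA : measurable A by exact: measurable_cell.
have hA : A `<=` @half_space R _ E by exact: cell_half_space.
have fA : (lebesgue_measure \x m)%E A \is a fin_num.
  by rewrite ge0_fin_numE//; exact: product_measure_cell_lty.
have mmu : measurable_fun setT (mu ^~ A) by exact: measurable_kernel.
(* [poisson_law] branches on the rate, so the finite intensity of the cell has to be displayed as a
   real number. *)
have [imu Emu] := poisson_law_mean mmu (fun w => measure_ge0 _ _)
  (eq_ind _ (poisson_law P (mu ^~ A)) (pmu _ mA hA) _ (esym (fineK fA))).
have ic : P.-integrable setT (fun _ : Omega => (fine ((lebesgue_measure \x m)%E A))%:E).
  exact: finite_measure_integrable_cst.
split.
- by have := integrableB measurableT imu ic; apply: eq_integrable.
- rewrite /compensated; under eq_integral do rewrite EFinB.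
  by rewrite integralB// Emu integral_cst//= probability_setT mule1 subee.
- move=> G D FG mD; have [_ ind] := nmu s s0; apply: ind => //.
  apply: sub_sigma_algebra.
  (* The independent algebra is generated by [mu] itself, so the compensation is moved into the
     measurable set. *)
  exists A, ((fun v => fine v - fine ((lebesgue_measure \x m)%E A)) @^-1` D).
  split=> //; first exact: cell_during.
  rewrite -[X in measurable X]setTI.
  have mh : measurable_fun setT
      (fun v => fine v - fine ((lebesgue_measure \x m)%E A)).
    by apply: measurable_funB => //; exact: fine_measurable.
  exact: mh.
Qed.

Lemma measurable_time_pos : measurable [set u : Omega * timed R E | 0 < u.2.1].
Proof.
rewrite (_ : [set _ | _] = setT `*` (`]0, +oo[ `*` setT)).
  by apply: measurableX => //; apply: measurableX.
by apply/seteqP; split=> -[w [x e]]/=; rewrite in_itv/= andbT => // -[_ []].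
Qed.

(** The generators are measurable rectangles because [F s] consists of events. The resulting joint
    measurability is what Tonelli requires later. *)
Lemma predictable_measurable (H : Omega * timed R E -> R) :
  filtration F -> predictable F H ->
  measurable_fun [set u : Omega * timed R E | 0 < u.2.1] H.
Proof.
move=> [Fs _] pH _ B mB; have := pH B mB.
have mpos := measurable_time_pos.
apply: (smallest_sub (G := [set _ | _])) => //; last first.
  move=> _ [A [s [t [C [s0 FA mC ->]]]]]; apply: measurableX.
    by have [_] := Fs _ s0; apply.
  exact: measurable_cell.
split=> //.
- by move=> A mA; exact: measurableD.
- by move=> A mA; exact: bigcupT_measurable.
Qed.

End noises.

(** * The heat semigroup *)

Section heat.
Context {R : realType}.

(** The inverse is the odd extension of the power with exponent -1; both take the value 0 at 0. *)
Lemma measurable_inv : measurable_fun setT (@GRing.inv R).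
Proof.
rewrite (_ : GRing.inv = fun x : R =>
    if 0 <= x then x `^ (-1) else - ((- x) `^ (-1))); last first.
  apply/funext => x; case: (leP 0 x) => x0; first by rewrite powR_inv1.
  by rewrite powR_inv1 ?oppr_ge0 ?ltW// invrN opprK.
apply: measurable_fun_ifT.
- exact: measurable_fun_ler.
- exact: measurable_powR.
- apply: measurableT_comp => //.
  exact: (measurableT_comp (f := fun x : R => x `^ (-1))).
Qed.

Lemma measurable_heat_kernel dT (T : measurableType dT) d (kappa : R) (a : T -> R)
    (u v : T -> xspace R d) :
  measurable_fun setT a -> measurable_fun setT u -> measurable_fun setT v ->
  measurable_fun setT (fun w => heat_kernel kappa (a w) (u w) (v w)).
Proof.
move=> ma mu mv; have mc c : measurable_fun setT (fun w => c * kappa * a w).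
  by apply: measurable_funM.
apply: measurable_funM.
  exact: (measurableT_comp (f := fun x : R => x `^ (- (d%:R / 2)))).
apply: measurableT_comp => //; apply: measurable_funM; last first.
  by apply: measurableT_comp; [exact: measurable_inv|exact: mc].
apply: measurableT_comp => //; apply: measurable_sum => i.
apply: measurable_funX; apply: measurable_funB.
  by apply: (measurableT_comp (measurable_tnth i)).
by apply: (measurableT_comp (measurable_tnth i)).
Qed.

Lemma ge0_integral_lebesgue_tupleS n (h : xspace R n.+1 -> \bar R) :
  measurable_fun setT h -> (forall v, 0 <= h v)%E ->
  (\int[lebesgue_tuple n.+1]_v h v =
   \int[lebesgue_measure]_x \int[lebesgue_tuple n]_v h (tcons (x, v)))%E.
Proof.
move=> mh h0.
transitivity (\int[lebesgue_measure \x lebesgue_tuple n]_p h (tcons p))%E.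
  by apply: ge0_integral_pushforward => //; exact: measurable_tcons.
rewrite (fubini_tonelli1 (h \o @tcons R n))//=.
by apply: measurableT_comp => //; exact: measurable_tcons.
Qed.

(** Induction on the dimension, splitting off the first coordinate; in dimension 0 the Dirac mass at
    the empty tuple gives the empty product. *)
Lemma integral_lebesgue_tuple_prod d (phi : 'I_d -> R -> R) (J : 'I_d -> R) :
  (forall i x, 0 <= phi i x) -> (forall i, measurable_fun setT (phi i)) ->
  (forall i, \int[lebesgue_measure]_x (phi i x)%:E = (J i)%:E)%E ->
  (\int[lebesgue_tuple d]_y (\prod_(i < d) phi i (tnth y i))%:E =
   (\prod_(i < d) J i)%:E)%E.
Proof.
elim: d phi J => [|d IH] phi J phi0 mphi phiJ.
  rewrite big_ord0 (eq_integral (cst 1%E)); last by move=> y _; rewrite big_ord0.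
  by rewrite integral_cst// mul1e/= diracT.
have mprod n (psi : 'I_n -> R -> R) : (forall i, measurable_fun setT (psi i)) ->
    measurable_fun setT (fun y : xspace R n => \prod_(i < n) psi i (tnth y i)).
  move=> mpsi; apply: measurable_prod => i _.
  by apply: (measurableT_comp (mpsi i)); exact: measurable_tnth.
rewrite ge0_integral_lebesgue_tupleS; last 2 first.
- by apply/measurable_EFinP; exact: mprod.
- by move=> v; rewrite lee_fin prodr_ge0.
have slice x : (\int[lebesgue_tuple d]_v
    (\prod_(i < d.+1) phi i (tnth (tcons (x, v)) i))%:E =
    (phi ord0 x)%:E * (\prod_(i < d) J (lift ord0 i))%:E)%E.
  rewrite -(IH (fun i => phi (lift ord0 i)))// -ge0_integralZl//.
  - apply: eq_integral => v _; rewrite big_ord_recl EFinM.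
    by congr (_ * (_)%:E)%E; apply: eq_bigr => i _; rewrite /tcons tnthS.
  - by apply/measurable_EFinP; apply: (@mprod d (fun i => phi (lift ord0 i))).
  - by move=> v _; rewrite lee_fin prodr_ge0.
  - by rewrite lee_fin.
under eq_integral do rewrite slice.
rewrite big_ord_recl EFinM -phiJ ge0_integralZr//.
- by apply/measurable_EFinP; exact: mphi.
- by move=> x _; rewrite lee_fin.
- rewrite lee_fin prodr_ge0// => i _.
  by rewrite -lee_fin -phiJ; apply: integral_ge0 => x _; rewrite lee_fin.
Qed.

(** This factorization reduces the kernel identities in R^d to Gaussian identities on the line, with
    variance [kappa * t]. *)
Lemma heat_kernel_prod d (kappa t : R) (x y : xspace R d) : 0 < kappa * t ->
  heat_kernel kappa t x y =
  \prod_(i < d) normal_pdf (tnth x i) (Num.sqrt (kappa * t)) (tnth y i).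
Proof.
move=> kt; have s0 : Num.sqrt (kappa * t) != 0 by rewrite gt_eqF// sqrtr_gt0.
rewrite (eq_bigr (fun i => normal_peak (Num.sqrt (kappa * t)) *
   normal_fun (tnth x i) (Num.sqrt (kappa * t)) (tnth y i))); last first.
  by move=> i _; rewrite normal_pdfE.
rewrite big_split/= prodr_const card_ord /heat_kernel; congr (_ * _).
  rewrite /normal_peak sqr_sqrtr ?ltW//.
  have a0 : 0 <= 2 * pi * kappa * t.
    by rewrite -mulrA mulr_ge0// ?(ltW kt)// mulr_ge0// pi_ge0.
  rewrite powRN (mulrC d%:R) powRrM powR12_sqrt// powR_mulrn ?sqrtr_ge0// -exprVn.
  by congr ((Num.sqrt _)^-1 ^+ d); rewrite -mulr_natr; ring.
rewrite /normal_fun -expR_sum; congr expR.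
rewrite /dist2 -sumrN mulr_suml; apply: eq_bigr => i _.
rewrite sqr_sqrtr ?ltW// -[in RHS]sqrrN opprB -[(kappa * t) *+ 2]mulr_natl.
by rewrite mulrA.
Qed.

Lemma heat_kernel_ge0 d (kappa t : R) (x y : xspace R d) :
  0 <= heat_kernel kappa t x y.
Proof. by rewrite mulr_ge0 ?powR_ge0 ?expR_ge0. Qed.

(** Completing the square in [y]: precisions 1/p and 1/q add up, and the new center is their
    weighted mean of [x] and [z]. *)
Lemma normal_pdf_mul (p q x y z : R) : 0 < p -> 0 < q ->
  normal_pdf x (Num.sqrt p) y * normal_pdf y (Num.sqrt q) z =
  normal_pdf x (Num.sqrt (p + q)) z *
  normal_pdf ((x * q + z * p) / (p + q)) (Num.sqrt (p * q / (p + q))) y.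
Proof.
move=> p0 q0; have pq0 : 0 < p + q by exact: addr_gt0.
have r0 : 0 < p * q / (p + q) by rewrite divr_gt0// mulr_gt0.
rewrite !normal_pdfE ?gt_eqF ?sqrtr_gt0// /normal_peak /normal_fun.
rewrite !sqr_sqrtr ?ltW// mulrACA [RHS]mulrACA; congr (_ * _).
  rewrite -!invfM -!sqrtrM ?mulrn_wge0 ?mulr_ge0 ?pi_ge0 ?ltW//.
  by congr ((Num.sqrt _)^-1); field; rewrite gt_eqF.
rewrite -!expRD; congr expR.
field; rewrite !gt_eqF//.
Qed.

Lemma integral_normal_pdf_mul (p q x z : R) : 0 < p -> 0 < q ->
  (\int[lebesgue_measure]_y
     (normal_pdf x (Num.sqrt p) y * normal_pdf y (Num.sqrt q) z)%:E =
   (normal_pdf x (Num.sqrt (p + q)) z)%:E)%E.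
Proof.
move=> p0 q0.
under eq_integral do rewrite normal_pdf_mul// EFinM.
rewrite ge0_integralZl//.
- by rewrite integral_normal_pdf mule1.
- by apply/measurable_EFinP; exact: measurable_normal_pdf.
- by move=> y _; rewrite lee_fin normal_pdf_ge0.
- by rewrite lee_fin normal_pdf_ge0.
Qed.

Lemma integral_heat_kernel d (kappa t : R) (x : xspace R d) : 0 < kappa * t ->
  (\int[lebesgue_tuple d]_y (heat_kernel kappa t x y)%:E = 1)%E.
Proof.
move=> kt; under eq_integral do rewrite heat_kernel_prod//.
rewrite (@integral_lebesgue_tuple_prod _
  (fun i y => normal_pdf (tnth x i) (Num.sqrt (kappa * t)) y) (fun=> 1)).
- by rewrite big1.
- by move=> i y; exact: normal_pdf_ge0.
- by move=> i; exact: measurable_normal_pdf.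
- by move=> i; rewrite integral_normal_pdf.
Qed.

Lemma integral_heat_kernel_mul d (kappa s t : R) (x z : xspace R d) :
  0 < kappa * s -> 0 < kappa * t ->
  (\int[lebesgue_tuple d]_y (heat_kernel kappa s x y * heat_kernel kappa t y z)%:E =
   (heat_kernel kappa (s + t) x z)%:E)%E.
Proof.
move=> ks kt.
have kst : 0 < kappa * (s + t) by rewrite mulrDr addr_gt0.
under eq_integral do rewrite !heat_kernel_prod// -big_split/=.
rewrite heat_kernel_prod//.
pose phi (i : 'I_d) (y : R) := normal_pdf (tnth x i) (Num.sqrt (kappa * s)) y *
  normal_pdf y (Num.sqrt (kappa * t)) (tnth z i).
rewrite (@integral_lebesgue_tuple_prod _ phi (fun i => normal_pdf (tnth x i)
  (Num.sqrt (kappa * (s + t))) (tnth z i)))//.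
- by move=> i y; rewrite mulr_ge0 ?normal_pdf_ge0.
- move=> i; rewrite /phi; under eq_fun do rewrite normal_pdf_mul//.
  by apply: measurable_funM => //; exact: measurable_normal_pdf.
- by move=> i; rewrite integral_normal_pdf_mul// mulrDr.
Qed.

End heat.

(** * Partial sums of the exponential series *)

Section exp_poly.
Context {R : realType}.

Lemma integral_deriv_poly (p : {poly R}) (t : R) : 0 < t ->
  (\int[lebesgue_measure]_(s in `[0%R, t]) (p^`().[s])%:E = (p.[t] - p.[0])%:E)%E.
Proof.
move=> t0; have cp (q : {poly R}) : continuous (horner q).
  move=> x; apply: differentiable_continuous; apply/derivable1_diffP.
  exact: derivable_horner.
rewrite (@continuous_FTC2 _ _ (horner p))//.
- by apply: continuous_subspaceT => x; exact: cp.
- split=> [x _||].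
  + exact: derivable_horner.
  + by apply: cvg_at_right_filter; exact: cp.
  + by apply: cvg_at_left_filter; exact: cp.
- by move=> x _; rewrite derivE.
Qed.

(** Encoded as a polynomial in time so that the time integral in the iteration is an instance of the
    fundamental theorem of calculus. *)
Definition exp_poly (a : R) n : {poly R} := \poly_(k < n) (a ^+ k / k`!%:R).

Lemma horner_exp_poly (a t : R) n :
  (exp_poly a n).[t] = series (exp_coeff (a * t)) n.
Proof.
rewrite horner_poly /series/= big_mkord; apply: eq_bigr => k _.
by rewrite /exp_coeff/= exprMn mulrAC.
Qed.

Lemma deriv_exp_poly (a : R) n : (exp_poly a n.+1)^`() = a *: exp_poly a n.
Proof.
apply/polyP => k; rewrite coef_deriv coefZ !coef_poly ltnS.
case: ltnP => _; last by rewrite mul0rn mulr0.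
rewrite exprS factS natrM -mulr_natr; field.
by rewrite pnatr_eq0 -lt0n fact_gt0 nat1r pnatr_eq0.
Qed.

Lemma exp_polyS0 (a : R) n : (exp_poly a n.+1).[0] = 1.
Proof. by rewrite horner_coef0 coef_poly/= expr0 divr1. Qed.

Lemma exp_poly_ge0 (a t : R) n : 0 <= a -> 0 <= t -> 0 <= (exp_poly a n).[t].
Proof.
move=> a0 t0; rewrite horner_poly sumr_ge0// => k _.
by rewrite mulr_ge0 ?exprn_ge0// divr_ge0 ?exprn_ge0.
Qed.

End exp_poly.

(** * The initial part and the iterated renewal inequality *)

Section initial.
Context {R : realType} (d : nat) (kappa : R) (f : xspace R d -> R).
Hypotheses (kappa0 : 0 < kappa) (mf : measurable_fun setT f).
Hypotheses (f0 : forall x, 0 <= f x) (fM : exists M, forall x, `|f x| <= M).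

Let mhf (t : R) (x : xspace R d) :
  measurable_fun setT (fun y => (heat_kernel kappa t x y * f y)%:E).
Proof.
apply/measurable_EFinP; apply: measurable_funM => //.
exact: measurable_heat_kernel.
Qed.

(** The real integral passes through [fine], which is faithful to finite values only; boundedness of
    [f] and the unit mass of the kernel supply finiteness. *)
Lemma initial_partE (t : R) (x : xspace R d) : 0 < t ->
  (initial_part kappa f t x)%:E =
  (\int[lebesgue_tuple d]_y (heat_kernel kappa t x y * f y)%:E)%E.
Proof.
move=> t0; have [M Mf] := fM.
have M0 : 0 <= M by apply: le_trans (Mf x).
rewrite /initial_part /Rintegral fineK// ge0_fin_numE; last first.
  by apply: integral_ge0 => y _; rewrite lee_fin mulr_ge0 ?heat_kernel_ge0.
apply: (@le_lt_trans _ _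
  (\int[lebesgue_tuple d]_y (M%:E * (heat_kernel kappa t x y)%:E))%E).
  apply: ge0_le_integral => //.
  - by move=> y _; rewrite lee_fin mulr_ge0 ?heat_kernel_ge0.
  - apply: emeasurable_funM => //; apply/measurable_EFinP.
    exact: measurable_heat_kernel.
  - move=> y _; rewrite -EFinM lee_fin mulrC ler_wpM2r ?heat_kernel_ge0//.
    by rewrite (le_trans _ (Mf y))// ler_norm.
rewrite ge0_integralZl//.
- by rewrite integral_heat_kernel ?mulr_gt0// mule1 ltry.
- by apply/measurable_EFinP; exact: measurable_heat_kernel.
- by move=> y _; rewrite lee_fin heat_kernel_ge0.
Qed.

Lemma initial_part_ge0 (t : R) (x : xspace R d) : 0 <= initial_part kappa f t x.
Proof.
by rewrite Rintegral_ge0// => y _; rewrite mulr_ge0 ?heat_kernel_ge0.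
Qed.

Lemma measurable_initial_part (t : R) : 0 < t ->
  measurable_fun setT (fun x => (initial_part kappa f t x)%:E).
Proof.
move=> t0; under eq_fun do rewrite initial_partE//.
pose h (p : xspace R d * xspace R d) := (heat_kernel kappa t p.1 p.2 * f p.2)%:E.
apply: (measurable_fun_fubini_tonelli_F h).
- apply/measurable_EFinP; apply: measurable_funM.
    exact: measurable_heat_kernel.
  exact: measurableT_comp.
- by move=> p; rewrite lee_fin mulr_ge0 ?heat_kernel_ge0.
Qed.

Lemma initial_part_semigroup (r s : R) (x : xspace R d) : 0 < r -> 0 < s ->
  (\int[lebesgue_tuple d]_y
     ((heat_kernel kappa r x y)%:E * (initial_part kappa f s y)%:E) =
   (initial_part kappa f (r + s) x)%:E)%E.
Proof.
move=> r0 s0.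
pose h (p : xspace R d * xspace R d) :=
  (heat_kernel kappa r x p.1 * heat_kernel kappa s p.1 p.2 * f p.2)%:E.
have mh : measurable_fun setT h.
  apply/measurable_EFinP; apply: measurable_funM; last exact: measurableT_comp.
  by apply: measurable_funM; exact: measurable_heat_kernel.
have h0 p : (0 <= h p)%E.
  rewrite lee_fin; apply: mulr_ge0 => //; apply: mulr_ge0; exact: heat_kernel_ge0.
transitivity (\int[lebesgue_tuple d]_y \int[lebesgue_tuple d]_z h (y, z))%E.
  apply: eq_integral => y _; rewrite initial_partE// -ge0_integralZl//.
  - by apply: eq_integral => z _; rewrite -EFinM mulrA.
  - by move=> z _; rewrite lee_fin mulr_ge0 ?heat_kernel_ge0.
  - by rewrite lee_fin heat_kernel_ge0.
rewrite fubini_tonelli// initial_partE ?addr_gt0//.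
apply: eq_integral => z _.
under eq_integral do rewrite /h/= EFinM.
rewrite ge0_integralZr//.
- by rewrite integral_heat_kernel_mul ?mulr_gt0.
- by apply/measurable_EFinP/measurable_funM; exact: measurable_heat_kernel.
- by move=> y _; rewrite lee_fin mulr_ge0 ?heat_kernel_ge0.
- by rewrite lee_fin.
Qed.

(** A Gronwall bound from below. Since [u] may be infinite, the induction compares integrals of
    nonnegative extended functions. *)
Lemma heat_renewal_lower (u : R -> xspace R d -> \bar R) (a : R) : 0 <= a ->
  (forall t x, (0 <= u t x)%E) ->
  measurable_fun setT (fun p : timed R (xspace R d) =>
    if 0 < p.1 then u p.1 p.2 else 0%E) ->
  (forall t x, 0 < t -> ((initial_part kappa f t x)%:E +
     \int[lebesgue_measure]_s \int[lebesgue_tuple d]_y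
       (if (0 < s < t)%R then (a * heat_kernel kappa (t - s) x y)%:E * u s y else 0)
     <= u t x)%E) ->
  forall t x, 0 < t -> ((expR (a * t) * initial_part kappa f t x)%:E <= u t x)%E.
Proof.
move=> a0 u0 mu ren.
have step n t x : 0 < t ->
    (((exp_poly a n).[t] * initial_part kappa f t x)%:E <= u t x)%E.
  elim: n t x => [|n IH] t x t0.
    by rewrite /exp_poly poly_def big_ord0 horner0 mul0r.
  apply: le_trans (ren t x t0).
  (* The value 1 at time 0 accounts for the free term; the increment is the time integral of the
     derivative [a *: exp_poly a n]. *)
  have -> : (exp_poly a n.+1).[t] =
      1 + ((exp_poly a n.+1).[t] - (exp_poly a n.+1).[0]).
    by rewrite exp_polyS0 subrKC.
  rewrite mulrDl mul1r EFinD leeD2l// EFinM -integral_deriv_poly// deriv_exp_poly.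
  rewrite muleC -ge0_integralZl//; last 3 first.
  - apply/measurable_EFinP; apply: measurable_funTS.
    apply: continuous_measurable_fun => s.
    apply: differentiable_continuous; apply/derivable1_diffP.
    exact: derivable_horner.
  - move=> s /=; rewrite in_itv/= => /andP[s0 _].
    by rewrite lee_fin hornerZ mulr_ge0// exp_poly_ge0.
  - by rewrite lee_fin initial_part_ge0.
  have mpoly (q : {poly R}) : measurable_fun setT (horner q).
    apply: continuous_measurable_fun => s.
    apply: differentiable_continuous; apply/derivable1_diffP.
    exact: derivable_horner.
  have mlhs : measurable_fun setT (fun s => (initial_part kappa f t x)%:E *
      ((a *: exp_poly a n).[s])%:E)%E.
    by apply: emeasurable_funM => //; apply/measurable_EFinP.
  (* Dropping the endpoints matches the open window of the renewal term. *)
  rewrite integral_itv_bndoo; last exact: measurable_funTS.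
  rewrite integral_mkcond.
  pose h (p : timed R (xspace R d)) : \bar R := if (0 < p.1 < t)%R then
    ((a * heat_kernel kappa (t - p.1) x p.2)%:E * u p.1 p.2)%E else 0%E.
  have h0 p : (0 <= h p)%E.
    rewrite /h; case: ifPn => // _; apply: mule_ge0 => //.
    by rewrite lee_fin mulr_ge0 ?heat_kernel_ge0.
  have mh : measurable_fun setT h.
    (* Measurability of [u] is given only after cutting it off at nonpositive times; inside the
       window the cut changes nothing. *)
    rewrite (_ : h = fun p => if (0 < p.1 < t)%R then
        ((a * heat_kernel kappa (t - p.1) x p.2)%:E *
        (if (0 < p.1)%R then u p.1 p.2 else 0))%E else 0%E); last first.
      by apply/funext => p; rewrite /h; case: ifPn => // /andP[-> _].
    apply: measurable_fun_ifT => //.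
      by apply: measurable_and; exact: measurable_fun_ltr.
    apply: emeasurable_funM => //; apply/measurable_EFinP.
    apply: measurable_funM => //; apply: measurable_heat_kernel => //.
    exact: measurable_funB.
  rewrite -[leRHS]/(\int[lebesgue_measure]_s \int[lebesgue_tuple d]_y h (s, y))%E.
  apply: ge0_le_integral => //.
  - move=> s _; rewrite patchE; case: ifPn => //; rewrite inE/= in_itv/= => /andP[s0 _].
    by rewrite -EFinM lee_fin hornerZ !mulr_ge0 ?initial_part_ge0 ?exp_poly_ge0 ?(ltW s0).
  - apply/(measurable_restrictT _ _).1; first exact: measurable_itv.
    exact: measurable_funTS.
  - exact: measurable_fun_fubini_tonelli_F.
  - move=> s _. rewrite patchE; case: ifPn; last by move=> _; exact: integral_ge0.
    rewrite inE/= in_itv/= => /andP[s0 st].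
    have ts0 : 0 < t - s by rewrite subr_gt0.
    (* Reading t as (t - s) + s puts the kernel at time t - s and the initial part at time s under
       one space integral, ready for the induction hypothesis. *)
    rewrite -[X in initial_part _ _ X _](subrK s t) -initial_part_semigroup//.
    have mfix : measurable_fun setT (fun y => (heat_kernel kappa (t - s) x y)%:E).
      by apply/measurable_EFinP; exact: measurable_heat_kernel.
    rewrite -ge0_integralZr//; last 3 first.
    - by apply: emeasurable_funM => //; exact: measurable_initial_part.
    - by move=> y _; rewrite mule_ge0// lee_fin ?heat_kernel_ge0 ?initial_part_ge0.
    - by rewrite lee_fin hornerZ mulr_ge0 ?exp_poly_ge0 ?(ltW s0).
    apply: ge0_le_integral => //.
    - move=> y _; rewrite !mule_ge0// lee_fin ?heat_kernel_ge0 ?initial_part_ge0//.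
      by rewrite hornerZ mulr_ge0 ?exp_poly_ge0 ?(ltW s0).
    - apply: emeasurable_funM => //.
      by apply: emeasurable_funM => //; exact: measurable_initial_part.
    - by apply: (measurableT_comp mh); exact: measurable_fun_pair.
    - move=> y _; rewrite /h/= s0 st/=.
      rewrite (_ : _ * _ = (a * heat_kernel kappa (t - s) x y)%:E *
          ((exp_poly a n).[s] * initial_part kappa f s y)%:E)%E; last first.
        by rewrite -!EFinM hornerZ; congr EFin; ring.
      rewrite lee_wpmul2l//; last exact: IH.
      by rewrite lee_fin mulr_ge0 ?heat_kernel_ge0.
move=> t x t0.
(* An infinite [u t x] satisfies the bound trivially; for a finite one the partial sums converge in
   the reals. *)
have [u_fin|] := boolP (u t x \is a fin_num); last first.
  by rewrite ge0_fin_numE// -leNgt leye_eq => /eqP ->; rewrite leey.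
rewrite -(fineK u_fin) lee_fin.
have cv : series (exp_coeff (a * t)) n * initial_part kappa f t x @[n --> \oo] -->
    expR (a * t) * initial_part kappa f t x.
  by apply: cvgMr_tmp; exact: is_cvg_series_exp_coeff.
rewrite -(cvg_lim (@norm_hausdorff _ _) cv); apply: limr_le.
  by apply/cvg_ex; exists (expR (a * t) * initial_part kappa f t x).
by apply: nearW => n; rewrite -lee_fin (fineK u_fin) -horner_exp_poly; exact: step.
Qed.

End initial.

(** * The renewal inequality for the first absolute moment *)

(* A name for the product measure to which sigma-finiteness can be attached: the
   library's instance for [\x] is shadowed. *)
Definition time_space_measure (R : realType) d :
  set (timed R (xspace R d)) -> \bar R := (lebesgue_measure \x lebesgue_tuple d)%E.
HB.instance Definition _ (R : realType) d := Measure.on (@time_space_measure R d).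
HB.instance Definition _ (R : realType) d :=
  Measure_isSigmaFinite.Build _ _ _ (@time_space_measure R d)
    (product_sigma_finite lebesgue_measure (lebesgue_tuple d)).

Lemma measurable_time_window (R : realType) (t : R) :
  measurable_fun setT (fun s : measurableTypeR R => 0 < s < t).
Proof. by apply: measurable_and; exact: measurable_fun_ltr. Qed.

Section renewal.
Context {R : realType} {dO : measure_display} {Omega : measurableType dO}.
Variables (P : probability Omega R) (F : R -> set (set Omega)).
Variables (d : nat) (kappa b rho L : R).
Variables (W : set (timed R (xspace R d)) -> Omega -> R).
Variables (lambda : {sigma_finite_measure set (measurableTypeR R) -> \bar R}).
Variables (mu : R.-ker Omega ~> timed R (xspace R d * measurableTypeR R)%type).
Variables (f : xspace R d -> R) (sigma : R -> R) (Y : R -> xspace R d -> Omega -> R).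
Hypotheses (FF : filtration F) (b0 : 0 <= b).
Hypothesis noise : levy_noise P F W lambda mu.
Hypotheses (msigma : measurable_fun setT sigma) (L0 : 0 <= L).
Hypothesis sigmaL : forall v, L * `|v| <= sigma v.
Hypothesis mild : mild_solution P F b rho W lambda mu kappa sigma f Y.

Definition abs_mean (t : R) (x : xspace R d) : \bar R := (\int[P]_w `|Y t x w|%:E)%E.

(** Predictability controls [Y] at positive times only; the cutoff is measurable on the whole
    product space. *)
Let Yp (u : Omega * timed R (xspace R d)) : R :=
  if 0 < u.2.1 then Y u.2.1 u.2.2 u.1 else 0.

Let mYp : measurable_fun setT Yp.
Proof.
have [pY _] := mild.
have mpos : measurable [set u : Omega * timed R (xspace R d) | 0 < u.2.1].
  exact: measurable_time_pos.
rewrite (_ : Yp = (fun u => Y u.2.1 u.2.2 u.1) \_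
    [set u : Omega * timed R (xspace R d) | 0 < u.2.1]).
  apply/(measurable_restrictT _ _).1 => //.
  exact: (predictable_measurable FF pY).
apply/funext => u; rewrite patchE /Yp; case: ifPn => up; case: ifPn => //.
  by rewrite notin_setE.
by rewrite inE/= (negbTE up).
Qed.

Lemma measurable_solution (t : R) (x : xspace R d) : 0 < t ->
  measurable_fun setT (Y t x).
Proof.
move=> t0; have : measurable_fun setT (fun w => Yp (w, (t, x))).
  by apply: (measurableT_comp mYp); exact: measurable_fun_pair.
by rewrite /Yp/= t0.
Qed.

Lemma measurable_abs_mean : measurable_fun setT
  (fun p : timed R (xspace R d) => if 0 < p.1 then abs_mean p.1 p.2 else 0%E).
Proof.
pose h (u : Omega * timed R (xspace R d)) : \bar R := `|Yp u|%:E.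
have := @measurable_fun_fubini_tonelli_G _ _ _ _ _ P h.
rewrite (_ : fubini_G _ _ = fun p : timed R (xspace R d) =>
    if 0 < p.1 then abs_mean p.1 p.2 else 0%E); last first.
  apply/funext => p; rewrite /fubini_G /h /Yp/=; case: ifPn => // _.
  by rewrite normr0 integral0.
apply; last by move=> u; rewrite lee_fin.
by apply/measurable_EFinP; exact: measurableT_comp.
Qed.

Lemma abs_mean_renewal (t : R) (x : xspace R d) : 0 < t ->
  ((initial_part kappa f t x)%:E +
     \int[lebesgue_measure]_s \int[lebesgue_tuple d]_y
       (if (0 < s < t)%R then (b * L * heat_kernel kappa (t - s) x y)%:E * abs_mean s y
        else 0)
     <= abs_mean t x)%E.
Proof.
move=> t0; have [_ sol] := mild.
have [X [[IW [IN [intH sW sN XE]]] YE]] := sol t x t0.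
have [_ wn pn] := noise.
have [iW EW] := stochastic_integral_mean0 FF (white_noise_mean_zero wn) sW.
have [iN EN] := stochastic_integral_mean0 FF (poisson_mean_zero pn) sN.
pose H (u : Omega * timed R (xspace R d)) : R := 
  if 0 < u.2.1 < t then heat_kernel kappa (t - u.2.1) x u.2.2 * sigma (Yp u) else 0.
have HE w s y : (if 0 < s < t then heat_kernel kappa (t - s) x y * sigma (Y s y w)
        else 0) = H (w, (s, y)).
  by rewrite /H /Yp/=; case: ifPn => // /andP[-> _].
have sigma0 v : 0 <= sigma v by rewrite (le_trans _ (sigmaL v))// mulr_ge0.
have H0 u : 0 <= H u.
  by rewrite /H; case: ifPn => // _; rewrite mulr_ge0 ?heat_kernel_ge0.
have ms : measurable_fun setT (fun u : Omega * timed R (xspace R d) => u.2.1).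
  by apply: (measurableT_comp measurable_fst); exact: measurable_snd.
have my : measurable_fun setT (fun u : Omega * timed R (xspace R d) => u.2.2).
  by apply: (measurableT_comp measurable_snd); exact: measurable_snd.
have mH : measurable_fun setT H.
  apply: measurable_fun_ifT => //.
    by apply: (measurableT_comp (measurable_time_window t)) ms.
  apply: measurable_funM; last exact: measurableT_comp.
  apply: measurable_heat_kernel => //; apply: measurable_funB => //; exact: ms.
have mbH : measurable_fun setT (fun u => (b * H u)%:E).
  by apply/measurable_EFinP; exact: measurable_funM.
pose I (w : Omega) : \bar R := (\int[@time_space_measure R d]_p (b * H (w, p))%:E)%E.
have bH0 u : (0 <= (b * H u)%:E)%E by rewrite lee_fin mulr_ge0.
have mI : measurable_fun setT I.
  exact: (measurable_fun_fubini_tonelli_F (fun u => (b * H u)%:E)).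
(* The drift in [levy_integral] is a real integral; its pathwise integrability identifies it with
   the extended integral [I]. *)
have IE : {ae P, forall w, I w = (Y t x w - initial_part kappa f t x - (IW w + IN w))%:E}.
  have Ihalf w :
    (\int[lebesgue_measure \x lebesgue_tuple d]_(u in @half_space R _ (xspace R d))
      (b * (let: (w, (s, y)) := (w, u) in
        if 0 < s < t then heat_kernel kappa (t - s) x y * sigma (Y s y w)
        else 0))%:E = I w)%E.
    rewrite integral_mkcond /I; apply: eq_integral => -[s y] _.
    rewrite patchE; case: ifPn => [_|]; first by rewrite HE.
    rewrite notin_setE /half_space /during/= in_itv/= andbT => /negP/negbTE s0.
    by rewrite /H/= s0 mulr0.
  apply: filterS3 intH XE YE => w iw xw yw; rewrite -Ihalf.
  have := integrable_fin_num (@measurable_half_space R _ (xspace R d)) iw.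
  move=> /fineK <-; congr EFin; rewrite yw xw /Rintegral; ring.
(* From here on [Y t x] is integrable, and through the pathwise equation so is [I]. *)
have [->|Yfin] := eqVneq (abs_mean t x) +oo%E; first by rewrite leey.
have mY := measurable_solution x t0.
have iY : P.-integrable setT (EFin \o Y t x).
  apply/integrableP; split; first exact/measurable_EFinP.
  by rewrite ltey.
have iV : P.-integrable setT (fun w => (IW w + IN w)%:E).
  by have := integrableD measurableT iW iN; apply: eq_integrable.
have EV : (\int[P]_w (IW w + IN w)%:E = 0)%E.
  under eq_integral do rewrite EFinD.
  by rewrite integralD//= EW EN adde0.
have ic : P.-integrable setT (fun=> (initial_part kappa f t x)%:E).
  exact: finite_measure_integrable_cst.
have iYc : P.-integrable setT (fun w => (Y t x w - initial_part kappa f t x)%:E).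
  by have := integrableB measurableT iY ic; apply: eq_integrable.
have iYV : P.-integrable setT
    (fun w => (Y t x w - initial_part kappa f t x - (IW w + IN w))%:E).
  by have := integrableB measurableT iYc iV; apply: eq_integrable.
have EI : ((initial_part kappa f t x)%:E + \int[P]_w I w = \int[P]_w (Y t x w)%:E)%E.
  rewrite (ae_eq_integral (fun w =>
    (Y t x w - initial_part kappa f t x - (IW w + IN w))%:E))//; last 2 first.
    exact: (measurable_int P iYV).
    by apply: filterS IE => w Iw _.
  under [X in (_ + X)%E]eq_integral do rewrite EFinB.
  rewrite integralB// EV sube0.
  under [X in (_ + X)%E]eq_integral do rewrite EFinB.
  rewrite integralB//= integral_cst//= probability_setT mule1.
  by rewrite addeC subeK.
(* Here E Y is replaced by the larger E|Y|. *)
apply: (@le_trans _ _ (\int[P]_w (Y t x w)%:E)%E); last first.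
  apply: (le_trans (lee_abs _)); apply: le_abse_integral => //.
  exact/measurable_EFinP.
rewrite -EI leeD2l//.
pose G (p : timed R (xspace R d)) : \bar R := (\int[P]_w (b * H (w, p))%:E)%E.
have mG : measurable_fun setT G.
  exact: (measurable_fun_fubini_tonelli_G (fun u => (b * H u)%:E)).
pose K (p : timed R (xspace R d)) : \bar R := if (0 < p.1 < t)%R then
  ((b * L * heat_kernel kappa (t - p.1) x p.2)%:E * abs_mean p.1 p.2)%E else 0%E.
have am0 s y : (0 <= abs_mean s y)%E.
  by apply: integral_ge0 => w _; rewrite lee_fin.
have K0 p : (0 <= K p)%E.
  rewrite /K; case: ifPn => // _; apply: mule_ge0 => //.
  by rewrite lee_fin !mulr_ge0 ?powR_ge0 ?expR_ge0.
have mK : measurable_fun setT K.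
  rewrite (_ : K = fun p => if (0 < p.1 < t)%R then
      ((b * L * heat_kernel kappa (t - p.1) x p.2)%:E *
      (if (0 < p.1)%R then abs_mean p.1 p.2 else 0))%E else 0%E); last first.
    by apply/funext => p; rewrite /K; case: ifPn => // /andP[-> _].
  apply: measurable_fun_ifT => //.
    exact: (measurableT_comp (measurable_time_window t)).
  apply: emeasurable_funM; last exact: measurable_abs_mean.
  apply/measurable_EFinP; apply: measurable_funM => //.
  by apply: measurable_heat_kernel => //; exact: measurable_funB.
apply: (@le_trans _ _ (\int[@time_space_measure R d]_p K p)%E).
  by rewrite /time_space_measure fubini_tonelli1.
(* With the expectation moved inside, it remains to compare integrands at each (s, y), where the
   lower bound on [sigma] enters. *)
rewrite /I (fubini_tonelli (fun u : Omega * timed R (xspace R d) => (b * H u)%:E))//.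
apply: ge0_le_integral => // -[s y] _; rewrite /K /G /H/=.
case: ifPn => [/andP[s0 st]|_]; last by apply: integral_ge0 => w _; rewrite mulr0.
rewrite /abs_mean -ge0_integralZl//; last 2 first.
  apply/measurable_EFinP; apply: measurableT_comp => //; exact: measurable_solution.
  by rewrite lee_fin !mulr_ge0 ?powR_ge0 ?expR_ge0.
apply: ge0_le_integral => //.
- move=> w _; rewrite -EFinM lee_fin mulr_ge0//.
  by rewrite !mulr_ge0 ?powR_ge0 ?expR_ge0.
- apply/measurable_EFinP; apply: measurable_funM => //.
  by apply: measurableT_comp => //; exact: measurable_solution.
- apply/measurable_EFinP; do 2 apply: measurable_funM => //.
  apply: (measurableT_comp msigma); apply: (measurableT_comp mYp).
  by apply: measurable_fun_pair => //; exact: measurable_fun_pair.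
- move=> w _; rewrite -EFinM lee_fin /Yp/= s0.
  rewrite -[X in X <= _]mulrA -[X in X <= _]mulrA ler_wpM2l// mulrCA.
  by rewrite ler_wpM2l ?heat_kernel_ge0.
Qed.

End renewal.

(** * Lower bounds on the growth exponents *)

Lemma lipschitz_continuous (R : realType) (g : R -> R) :
  [lipschitz g u | u in setT] -> continuous g.
Proof.
move=> /pinfty_ex_gt0[M M0 gM] x; apply/cvgrPdist_lt => e e0.
have eM : 0 < e / M by rewrite divr_gt0.
near=> y; have := gM (x, y) (conj I I); rewrite /self_sub/= => /le_lt_trans; apply.
by rewrite mulrC -ltr_pdivlMr//; near: y; exact: cvgr_dist_lt.
Unshelve. all: by end_near. Qed.

Lemma L_sigma_le (R : realType) (sigma : R -> R) : (forall u, 0 <= sigma u) ->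
  forall v, L_sigma sigma * `|v| <= sigma v.
Proof.
move=> s0 v; have [->|v0] := eqVneq v 0; first by rewrite normr0 mulr0.
rewrite -ler_pdivlMr ?normr_gt0// (_ : sigma v / _ = `|sigma v| / `|v|); last first.
  by rewrite (ger0_norm (s0 v)).
apply: ge_inf; last by exists v.
by exists 0 => _ [y _ <-]; rewrite divr_ge0.
Qed.

(** * Lower bounds on the initial part *)

Section initial_lower.
Context {R : realType} (d : nat) (kappa : R) (f : xspace R d -> R).
Hypotheses (kappa0 : 0 < kappa) (mf : measurable_fun setT f).
Hypotheses (f0 : forall x, 0 <= f x) (fM : exists M, forall x, `|f x| <= M).

Lemma initial_part_ge (l t : R) (x : xspace R d) : (forall y, l <= f y) ->
  0 <= l -> 0 < t -> l <= initial_part kappa f t x.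
Proof.
move=> lf l0 t0; rewrite -lee_fin initial_partE//.
have mh : measurable_fun setT (fun y => (heat_kernel kappa t x y)%:E).
  by apply/measurable_EFinP; exact: measurable_heat_kernel.
rewrite -[l%:E]mule1 -(integral_heat_kernel x (mulr_gt0 kappa0 t0)).
rewrite -ge0_integralZl//; last by move=> y _; rewrite lee_fin heat_kernel_ge0.
apply: ge0_le_integral => //.
- by move=> y _; rewrite mule_ge0// lee_fin heat_kernel_ge0.
- exact: emeasurable_funM.
- apply/measurable_EFinP; apply: measurable_funM => //.
  exact: measurable_heat_kernel.
- by move=> y _; rewrite -EFinM lee_fin mulrC ler_wpM2l ?heat_kernel_ge0.
Qed.

Definition sqnorm (x : xspace R d) : R := \sum_(i < d) tnth x i ^+ 2.

Lemma measurable_sqnorm : measurable_fun setT sqnorm.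
Proof.
by apply: measurable_sum => i; apply: measurable_funX; exact: measurable_tnth.
Qed.

Lemma measurable_sqnorm_ball (r : R) : measurable [set y | (sqnorm y <= r)%R].
Proof.
rewrite -[X in measurable X]setTI.
rewrite (_ : [set y | _] = sqnorm @^-1` `]-oo, r]); last first.
  by apply/seteqP; split=> y /=; rewrite in_itv.
by apply: measurable_sqnorm => //; exact: measurable_itv.
Qed.

Lemma dist2_le (x y : xspace R d) : dist2 x y <= 2 * (sqnorm x + sqnorm y).
Proof.
rewrite /dist2 /sqnorm -big_split/= mulr_sumr ler_sum// => i _.
have := sqr_ge0 (tnth x i + tnth y i); nra.
Qed.

(** Otherwise [f] would vanish almost everywhere on every ball, and countably many balls exhaust the
    space. A bounded region is wanted to control |x - y| uniformly in y. *)
Lemma positive_on_ball : (0 < lebesgue_tuple d [set x | (0 < f x)%R])%E ->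
  exists n : nat,
    (0 < \int[lebesgue_tuple d]_(y in [set y | (sqnorm y <= n%:R)%R]) (f y)%:E)%E.
Proof.
move=> fpos; apply: contrapT => /forallNP H.
have mfE : measurable_fun setT (fun y => (f y)%:E) by exact/measurable_EFinP.
have N0 n : (lebesgue_tuple d).-negligible [set y | (sqnorm y <= n%:R)%R /\ (0 < f y)%R].
  have I0 :
    (\int[lebesgue_tuple d]_(y in [set y | (sqnorm y <= n%:R)%R]) `|(f y)%:E| = 0)%E.
    under eq_integral do rewrite gee0_abs ?lee_fin//.
    apply/eqP; rewrite eq_le integral_ge0 ?andbT; last by move=> y _; rewrite lee_fin.
    by rewrite leNgt; apply/negP; exact: H.
  have /(ae_eq_integral_abs _ (measurable_sqnorm_ball n%:R) (measurable_funTS mfE)) := I0.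
  apply: negligibleS => y /= [yn fy]; apply/not_implyP; split=> //.
  by case=> fy0; rewrite fy0 ltxx in fy.
have := negligible_bigcup N0.
rewrite (_ : \bigcup_k _ = [set x | (0 < f x)%R]); last first.
  apply/seteqP; split=> [y [n _ []]//|y fy].
  exists (Num.truncn (sqnorm y)).+1 => //; split=> //.
  by rewrite ltW// truncnS_gt.
have mpos : measurable [set x | (0 < f x)%R].
  rewrite -[X in measurable X]setTI.
  rewrite (_ : [set y | _] = f @^-1` `]0, +oo[); last first.
    by apply/seteqP; split=> y /=; rewrite in_itv/= andbT.
  by apply: mf => //; exact: measurable_itv.
by move/(measure_negligible mpos) => f00; rewrite f00 ltxx in fpos.
Qed.

(** Only y in a ball of squared radius [n] is kept. There |x - y|^2 <= 2 (|x|^2 + n), and this 2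
    cancels the one in the exponent of the kernel. *)
Lemma initial_part_gaussian_lower :
  (0 < lebesgue_tuple d [set x | (0 < f x)%R])%E ->
  exists n C : R, 0 < C /\ forall t x, 0 < t ->
    C * ((2 * pi * kappa * t) `^ (- (d%:R / 2)) *
      expR (- (sqnorm x + n) / (kappa * t))) <= initial_part kappa f t x.
Proof.
move=> /positive_on_ball[n]; set B := [set y | _]; set c := (\int[_]_(_ in _) _)%E => c0.
have mB : measurable B by exact: measurable_sqnorm_ball.
have mfE : measurable_fun setT (fun y => (f y)%:E) by exact/measurable_EFinP.
pose k t x := (2 * pi * kappa * t) `^ (- (d%:R / 2)) *
  expR (- (sqnorm x + n%:R) / (kappa * t)).
have k_ge0 t x : 0 <= k t x by rewrite mulr_ge0 ?powR_ge0 ?expR_ge0.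
have lower t x : 0 < t -> ((k t x)%:E * c <= (initial_part kappa f t x)%:E)%E.
  move=> t0; rewrite initial_partE// /c -ge0_integralZl//; last 3 first.
  - exact: measurable_funTS.
  - by move=> y _; rewrite lee_fin.
  - by rewrite lee_fin.
  apply: (@le_trans _ _
    (\int[lebesgue_tuple d]_(y in B) (heat_kernel kappa t x y * f y)%:E)%E).
    have mhf : measurable_fun setT (fun y => (heat_kernel kappa t x y * f y)%:E).
      apply/measurable_EFinP; apply: measurable_funM => //.
      exact: measurable_heat_kernel.
    apply: ge0_le_integral => //.
    - by move=> y _; rewrite mule_ge0// lee_fin.
    - by apply: measurable_funTS; exact: emeasurable_funM.
    - exact: measurable_funTS.
    - move=> y yB; rewrite -EFinM lee_fin ler_wpM2r// ler_wpM2l ?powR_ge0//.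
      rewrite ler_expR [leRHS](_ : _ = - (dist2 x y / 2) / (kappa * t)); last first.
        by field; rewrite !gt_eqF.
      rewrite ler_pM2r ?invr_gt0 ?mulr_gt0// lerN2 ler_pdivrMr// mulrC.
      by rewrite (le_trans (dist2_le x y))// ler_wpM2l// lerD2l.
  apply: ge0_subset_integral => //.
  - apply/measurable_EFinP; apply: measurable_funM => //.
    exact: measurable_heat_kernel.
  - by move=> y _; rewrite lee_fin mulr_ge0 ?heat_kernel_ge0.
have k0 t x : 0 < t -> 0 < k t x.
  move=> t0; rewrite mulr_gt0 ?expR_gt0// powR_gt0//.
  by rewrite !mulr_gt0// pi_gt0.
(* The bound just proved yields finiteness: at t = 1, x = 0 an infinite [c] would force an infinite
   value of the real-valued initial part. *)
have cfin : c \is a fin_num.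
  rewrite ge0_fin_numE ?(ltW c0)// ltNge leye_eq; apply/negP => /eqP cy.
  pose x : xspace R d := [tuple 0 | i < d].
  have := lower 1 x ltr01; rewrite cy gt0_muley ?lte_fin ?k0//.
exists n%:R, (fine c); split; first by rewrite fine_gt0// c0 ltey_eq cfin.
move=> t x t0; rewrite -lee_fin EFinM fineK// muleC; exact: lower.
Qed.

End initial_lower.

(** * From exponential moment bounds to the exponents *)

Section growth.
Context {R : realType}.

Lemma linear_half_le (a K t : R) : 0 < a -> 2 * K / a <= t -> a / 2 * t <= a * t - K.
Proof. move=> a0; rewrite ler_pdivrMr// => Kt; nra. Qed.

Lemma lne_expR_le (r : R) (m : \bar R) : ((expR r)%:E <= m -> r%:E <= lne m)%E.
Proof.
move=> rm; have e0 : (0 <= (expR r)%:E)%E by rewrite lee_fin expR_ge0.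
rewrite -[r]expRK -lne_EFin ?expR_gt0// lee_lne//= in_itv/= leey andbT//.
exact: le_trans rm.
Qed.

Lemma powR_neg_half_ge (a k : R) d : 0 < a -> 0 < k -> (0 < d)%N ->
  exists K, forall t, 0 < t -> expR (- (a * t) - K) <= (k * t) `^ (- (d%:R / 2)).
Proof.
move=> a0 k0 d0; have dR : 0 < d%:R :> R by rewrite ltr0n.
(* The inequality ln z <= z at z = [e * (k * t)], multiplied by d/2, has right-hand side exactly
   [a * t]; the term in ln e becomes the constant. *)
pose e := a / (d%:R / 2 * k).
have e0 : 0 < e by rewrite divr_gt0// mulr_gt0// divr_gt0.
exists (- (d%:R / 2 * ln e)) => t t0.
have kt : 0 < k * t by exact: mulr_gt0.
rewrite /powR (gt_eqF kt) ler_expR.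
have := ln_sublinear (mulr_gt0 e0 kt); move=> h.
have -> : a * t = d%:R / 2 * (e * (k * t)) by rewrite /e; field; rewrite !gt_eqF.
have : 0 <= d%:R / 2 * (e * (k * t) - (ln e + ln (k * t))).
  apply: mulr_ge0; first by rewrite divr_ge0 ?ler0n.
  by rewrite subr_ge0 -lnM ?posrE// ltW.
lra.
Qed.

Section exponents.
Context {dO : measure_display} {Omega : measurableType dO}.
Variables (P : probability Omega R) (d : nat) (Y : R -> xspace R d -> Omega -> R).

Lemma gamma_lower_gt0 (p a K : R) : 0 < a ->
  (forall t x, 0 < t -> ((expR (a * t - K))%:E <= moment P Y p t x)%E) ->
  (0 < gamma_lower P Y p)%E.
Proof.
move=> a0 le_moment; apply: (@lt_le_trans _ _ (a / 2)%:E).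
  by rewrite lte_fin divr_gt0.
rewrite /gamma_lower limf_einfE.
(* Beyond [2 * K / a] the constant costs at most half of the rate; the 1 keeps times positive. *)
pose T := Num.max 1 (2 * K / a).
apply: le_ereal_sup_tmp; exists (ereal_inf [set ((t^-1)%:E *
    ereal_inf [set lne (moment P Y p t x) | x in setT])%E | t in `]T, +oo[]).
  exists `]T, +oo[%classic => //; exists T; split; first exact: num_real.
  by move=> t; rewrite /= in_itv/= andbT.
apply: le_ereal_inf_tmp => _ [t /= + <-]; rewrite in_itv/= andbT gt_max => /andP[t1 tK].
have t0 : 0 < t by exact: lt_trans t1.
rewrite muleC lee_pdivlMr// -EFinM.
apply: le_ereal_inf_tmp => _ [x _ <-]; apply: lne_expR_le.
apply: le_trans (le_moment t x t0); rewrite lee_fin ler_expR.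
by rewrite linear_half_le// ltW.
Qed.

(** One rate [alpha] in the set is enough, the exponent being a supremum; one point per time is
    enough, since the inner supremum runs over all |x| >= alpha t. *)
Lemma lambda_lower_gt0 (p alpha a K : R) : 0 < alpha -> 0 < a ->
  (forall t, 1 <= t -> exists2 x, alpha * t <= eucl x &
    ((expR (a * t - K))%:E <= moment P Y p t x)%E) ->
  (0 < lambda_lower P Y p)%E.
Proof.
move=> alpha0 a0 le_moment; apply: (@lt_le_trans _ _ alpha%:E); first by rewrite lte_fin.
apply: ereal_sup_ubound; right; exists alpha => //; split=> //.
apply: (@lt_le_trans _ _ (a / 2)%:E); first by rewrite lte_fin divr_gt0.
apply: le_ereal_inf_tmp => _ [V [M [_ MV]] <-].
(* A time inside the given neighbourhood of infinity, late enough for half of the rate to absorb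
   [K]. *)
pose t := Num.max (M + 1) (Num.max 1 (2 * K / a)).
have Mt : M < t by rewrite lt_max ltrDl ltr01.
have t1 : 1 <= t by rewrite !le_max lexx orbT.
have tK : 2 * K / a <= t by rewrite !le_max lexx !orbT.
have t0 : 0 < t by exact: lt_le_trans t1.
apply: le_ereal_sup_tmp; eexists; first by exists t => //; exact: MV.
have [x xt xm] := le_moment t t1.
rewrite muleC lee_pdivlMr// -EFinM.
apply: le_ereal_sup_tmp; exists (lne (moment P Y p t x)); first by exists x.
apply: lne_expR_le; apply: le_trans xm; rewrite lee_fin ler_expR.
exact: linear_half_le.
Qed.

End exponents.
End growth.

Lemma exists_eucl_eq (R : realType) d (r : R) : (0 < d)%N -> 0 <= r ->
  exists x : xspace R d, sqnorm x = r ^+ 2 /\ eucl x = r.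
Proof.
case: d => // d _ r0.
pose x : xspace R d.+1 := [tuple (if i == ord0 then r else 0) | i < d.+1].
have xr : sqnorm x = r ^+ 2.
  rewrite /sqnorm big_ord_recl tnth_mktuple eqxx big1 ?addr0// => i _.
  by rewrite tnth_mktuple /= expr0n.
exists x; split=> //; rewrite /eucl -/(sqnorm x) xr sqrtr_sqr ger0_norm//.
Qed.

Lemma exp_initial_part_lower (R : realType) d (kappa a : R) (f : xspace R d -> R) :
  0 < kappa -> (0 < d)%N -> 0 < a -> measurable_fun setT f -> (forall x, 0 <= f x) ->
  (exists M, forall x, `|f x| <= M) ->
  (0 < lebesgue_tuple d [set x | (0 < f x)%R])%E ->
  exists alpha K : R, 0 < alpha /\ forall t, 1 <= t ->
    exists2 x, alpha * t <= eucl x &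
      expR (a / 4 * t - K) <= expR (a * t) * initial_part kappa f t x.
Proof.
move=> kappa0 d0 a0 mf f0 fM fpos.
have [n [C [C0 lower]]] := initial_part_gaussian_lower kappa0 mf f0 fM fpos.
have pk0 : 0 < 2 * pi * kappa by rewrite !mulr_gt0 ?pi_gt0.
have [K poly] := powR_neg_half_ge (divr_gt0 a0 (ltr0n _ 4)) pk0 d0.
(* Then [|x| = alpha t] costs [a t / 2] in the exponent; the power of [t] costs
   another [a t / 4]. *)
pose alpha := Num.sqrt (a * kappa / 2).
have alpha2 : alpha ^+ 2 = a * kappa / 2.
  by rewrite sqr_sqrtr// divr_ge0// mulr_ge0 ?ltW.
(* The constant gathers the one from the power of t, the bound on n / (kappa t) for t >= 1, and the
   prefactor [C]. The sign of [n] is not recorded, hence the absolute value. *)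
exists alpha, (K + `|n| / kappa - ln C); split.
  by rewrite sqrtr_gt0 divr_gt0// mulr_gt0.
move=> t t1; have t0 : 0 < t by exact: lt_le_trans t1.
have [x [xs xe]] := @exists_eucl_eq R d (alpha * t) d0 (mulr_ge0 (sqrtr_ge0 _) (ltW t0)).
exists x; first by rewrite xe.
have := lower t x t0; rewrite -(ler_pM2l (expR_gt0 (a * t))); apply: le_trans.
have -> : expR (a / 4 * t - (K + `|n| / kappa - ln C)) =
    expR (a * t) * (C * (expR (- (a / 4 * t) - K) * expR (- (a / 2 * t) - `|n| / kappa))).
  have CE : C = expR (ln C) by rewrite lnK.
  rewrite {2}CE -!expRD; congr expR; set l := ln C; set z := `|n| / kappa.
  lra.
rewrite (ler_pM2l (expR_gt0 _)) (ler_pM2l C0).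
apply: (ler_pM (expR_ge0 _) (expR_ge0 _) (poly t t0)).
rewrite ler_expR xs exprMn alpha2.
have -> : - (a * kappa / 2 * t ^+ 2 + n) / (kappa * t) =
    - (a / 2 * t) - n / kappa / t by field; rewrite !gt_eqF.
rewrite lerD2l lerN2 ler_pdivrMr//.
apply: (@le_trans _ _ (`|n| / kappa)); first by rewrite ler_pM2r ?invr_gt0// ler_norm.
by rewrite ler_peMr// divr_ge0// ltW.
Qed.

Theorem theorem3p10 (R : realType)
  (dO : measure_display) (Omega : measurableType dO) (P : probability Omega R)
  (F : R -> set (set Omega)) (d : nat) (kappa b rho c q : R)
  (W : set (timed R (xspace R d)) -> Omega -> R)
  (lambda : {sigma_finite_measure set (measurableTypeR R) -> \bar R})
  (mu : R.-ker Omega ~> timed R (xspace R d * measurableTypeR R)%type)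
  (f : xspace R d -> R) (sigma : R -> R)
  (Y : R -> xspace R d -> Omega -> R) :
  filtration F ->
  (0 < d)%N ->
  0 < kappa ->
  levy_noise P F W lambda mu ->
  0 <= c ->
  measurable_fun setT f ->
  (exists M, forall x, `|f x| <= M) ->
  exp_decay c f ->
  (forall u, 0 <= sigma u) ->
  [lipschitz sigma u | u in setT] ->
  (0 < c -> sigma 0 = 0) ->
  0 < L_sigma sigma ->
  1 <= q < 1 + 2 / d%:R ->
  (m_lambda lambda q < +oo)%E ->
  (q < 2 -> rho = 0) ->
  mild_solution P F b rho W lambda mu kappa sigma f Y ->
  moment_bound P Y c q ->
  (c = 0 -> 0 < inf (range f)) ->
  (0 < c -> (forall x, 0 <= f x) /\
     (0 < lebesgue_tuple d [set x | (0 < f x)%R])%E) ->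
  0 < b ->
  (c = 0 -> (0 < gamma_lower P Y 1)%E) /\
  (0 < c -> (0 < lambda_lower P Y 1)%E).
Proof.
move=> FF d0 kappa0 noise c0 mf fM _ sigma0 lip _ L0 _ _ _ mild _ fc0 fc b0.
set L := L_sigma sigma in L0; have a0 : 0 < b * L by exact: mulr_gt0.
have msigma : measurable_fun setT sigma.
  by apply: continuous_measurable_fun; exact: (lipschitz_continuous lip).
have moment1 t x : moment P Y 1 t x = abs_mean P Y t x.
  rewrite /moment /abs_mean unlock; apply: eq_integral => w _.
  by rewrite powRr1.
(* Nonnegativity of [f] stays a premise because the two cases obtain it differently. *)
have lower : (forall x, 0 <= f x) -> forall t x, 0 < t ->
    ((expR (b * L * t) * initial_part kappa f t x)%:E <= moment P Y 1 t x)%E.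
  move=> f0 t x t0; rewrite moment1.
  apply: (heat_renewal_lower kappa0 mf f0 fM (u := abs_mean P Y)) => //.
  - exact: ltW.
  - by move=> s y; apply: integral_ge0 => w _; rewrite lee_fin.
  - exact: (measurable_abs_mean FF mild).
  - move=> s y; apply: (abs_mean_renewal FF (ltW b0) noise msigma (ltW L0) _ mild).
    exact: L_sigma_le.
split=> [cE|cpos].
- have l0 := fc0 cE; set l := inf (range f) in l0.
  have lf y : l <= f y.
    apply: ge_inf; last by exists y.
    have [M Mf] := fM; exists (- M) => _ [z _ <-].
    by have := Mf z; rewrite ler_norml => /andP[].
  have f0 y : 0 <= f y by rewrite (le_trans (ltW l0)).
  (* The lower bound [l] on the initial part enters as exp(ln l). *)
  apply: (@gamma_lower_gt0 _ _ _ _ _ _ _ (b * L) (- ln l)) => // t x t0.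
  apply: le_trans (lower f0 t x t0); rewrite lee_fin opprK expRD lnK ?posrE//.
  rewrite (ler_pM2l (expR_gt0 _)).
  exact: (initial_part_ge kappa0 mf f0 fM x lf (ltW l0) t0).
- have [f0 fpos] := fc cpos.
  have [alpha [K [alpha0 low]]] := exp_initial_part_lower kappa0 d0 a0 mf f0 fM fpos.
  apply: (@lambda_lower_gt0 _ _ _ _ _ _ _ alpha (b * L / 4) K) => //.
    by rewrite divr_gt0.
  move=> t t1; have [x ax xl] := low t t1; exists x => //.
  apply: le_trans (lower f0 t x (lt_le_trans ltr01 t1)).
  by rewrite lee_fin.
Qed.
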